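(* Let $n\geq 2$ be an integer. Then every limit-min/max capacity-generating set for $\operatorname{Symp}^{2n}$ has cardinality strictly bigger than that of the continuum.
   Context: Manifolds are smooth, real, finite-dimensional, Hausdorff and second countable; they may be disconnected and may have boundary. An embedding is an injective smooth immersion with continuous inverse (no condition involving the boundaries is imposed). $\operatorname{Symp}^{2n}$ is the category of all symplectic manifolds of dimension $2n$, with morphisms the symplectic embeddings. The continuum is the cardinality of $\mathbb{R}$. Let $\beth_0:=|\mathbb{N}_0|$, $\beth_1:=2^{\beth_0}$, regarded as a von Neumann cardinal, hence as a set. Let $\mathcal{O}_0$ be the set of all objects $(M,\omega)$ of $\operatorname{Symp}^{2n}$ such that the set underlying $M$ is a subset of $\beth_1$ (every object of $\operatorname{Symp}^{2n}$ is isomorphic to one in $\mathcal{O}_0$). A generalized capacity on $\operatorname{Symp}^{2n}$ is a function $c:\mathcal{O}_0\to[0,\infty]$ such that (monotonicity) $c(M,\omega)\leq c(M',\omega')$ whenever there is a symplectic embedding $(M,\omega)\to(M',\omega')$ between elements of $\mathcal{O}_0$, and (conformality) $c(M,a\omega)=a\,c(M,\omega)$ for all $(M,\omega)\in\mathcal{O}_0$ and $a\in(0,\infty)$. Let $\mathcal{C}ap$ be the set of all generalized capacities on $\operatorname{Symp}^{2n}$. A subset $\mathcal{G}\subseteq\mathcal{C}ap$ is called limit-min/max (capacity-)generating if every $c\in\mathcal{C}ap$ is the pointwise limit of a sequence of functions each of which has the form $f\circ(c_1,\ldots,c_\ell)$, where $\ell\in\mathbb{N}_0$, $c_1,\ldots,c_\ell\in\mathcal{G}$,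 and the combining function $f:[0,\infty]^\ell\to[0,\infty]$ is the minimum or the maximum of the $\ell$ coordinates. *)

(* Defs.v *)
From HB Require Import structures.
From mathcomp Require Import all_boot all_order all_algebra.
From mathcomp Require Import all_classical all_reals all_analysis.

Set Implicit Arguments.
Unset Strict Implicit.
Unset Printing Implicit Defensive.

Import Order.TTheory GRing.Theory Num.Theory numFieldNormedType.Exports.

Local Open Scope classical_set_scope.
Local Open Scope ring_scope.

Section Euclidean.
Context {R : realType}.

(* The iterated partial derivative along the coordinates listed in [s] (the
   head of [s] is the last direction in which one differentiates). *)
Definition iter_partial (m : nat) (V : normedModType R) (s : seq 'I_m)
    (g : 'rV[R]_m -> V) : 'rV[R]_m -> V :=
  foldr (fun i h x => 'D_(delta_mx 0 i) h x) g s.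

(* C^oo on an open set [W]: every iterated partial derivative exists and is
   continuous at every point of [W]. *)
Definition smooth_on (m : nat) (V : normedModType R) (W : set 'rV[R]_m)
    (g : 'rV[R]_m -> V) : Prop :=
  forall (s : seq 'I_m) (x : 'rV[R]_m), W x ->
    {for x, continuous (iter_partial s g)} /\
    (forall i : 'I_m, derivable (iter_partial s g) x (delta_mx 0 i)).

(* The model space: the first coordinate is nonnegative.  The quantification
   over [i] makes it the one-point space when m = 0. *)
Definition halfspace (m : nat) : set 'rV[R]_m :=
  [set x | forall i : 'I_m, nat_of_ord i = 0%N -> 0 <= x 0 i].

End Euclidean.

(* A topological space whose underlying set is a subset of [set nat], the power
   set of the natural numbers, which plays the role of the cardinal beth_1. *)
Record small_space := SmallSpace {
  carrier : set (set nat);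
  opens : set (set (set_type carrier));
  opens_setT : opens setT;
  opens_setI : forall A B, opens A -> opens B -> opens (A `&` B);
  opens_bigcup : forall (I : Type) (f : I -> set (set_type carrier)),
    (forall i, opens (f i)) -> opens (\bigcup_i f i) }.

(* An alias, so that the topology given by [opens] is not confused with
   canonical topologies on subtypes. *)
Definition points (X : small_space) : Type := set_type (carrier X).

HB.instance Definition _ (X : small_space) := gen_eqMixin (points X).
HB.instance Definition _ (X : small_space) := gen_choiceMixin (points X).
HB.instance Definition _ (X : small_space) :=
  @isOpenTopological.Build (points X) (@opens X)
    (@opens_setT X) (@opens_setI X) (@opens_bigcup X).

Section Charts.
Context {R : realType} {m : nat}.

(* The values of [coord] outside [dom] are irrelevant. *)
Record chart (X : Type) := Chart {
  dom : set X;
  coord : X -> 'rV[R]_m }.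

(* [coord] restricts to a homeomorphism from the open set [dom] to a
   relatively open subset of the half-space. *)
Definition is_chart (X : topologicalType) (c : chart X) : Prop :=
  [/\ open (dom c),
      set_inj (dom c) (coord c),
      {within dom c, continuous (coord c)} &
      forall A : set X, open A -> A `<=` dom c ->
        exists2 O : set 'rV[R]_m, open O & coord c @` A = O `&` @halfspace R m].

(* [g] is smooth near [coord c p], and there it extends the function [f], read
   in the chart [c] and restricted to [D].  At boundary points this is the
   usual notion of smoothness on a subset that is not open; when [D] is a
   neighbourhood of [p], the derivatives of [g] at [coord c p] do not depend
   on the choice of [g]. *)
Definition local_ext (X : Type) (V : normedModType R) (c : chart X)
    (D : set X) (p : X) (f : X -> V) (g : 'rV[R]_m -> V) : Prop :=
  exists W : set 'rV[R]_m,
    [/\ open W, W (coord c p), smooth_on W g &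
        forall q, D q -> dom c q -> W (coord c q) -> g (coord c q) = f q].

End Charts.
Arguments chart R m X : clear implicits.

(* [g] is a smooth extension near [coord c p] of (coord d) o f o (coord c)^-1 *)
Definition local_rep {R : realType} {m k : nat} (X Y : Type)
    (c : chart R m X) (d : chart R k Y) (f : X -> Y) (p : X)
    (g : 'rV[R]_m -> 'rV[R]_k) : Prop :=
  local_ext c (f @^-1` dom d) p (coord d \o f) g.

Definition compatible {R : realType} {m : nat} (X : Type)
    (c d : chart R m X) : Prop :=
  forall p, dom c p -> dom d p -> exists g, local_rep c d id p g.

Record manifold (R : realType) (m : nat) := Manifold {
  space :> small_space;
  atlas : set (chart R m (points space));
  manifold_hausdorff : hausdorff_space (points space);
  manifold_second_countable : @second_countable (points space);
  atlas_is_chart : forall c, atlas c -> is_chart c;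
  atlas_cover : forall p, exists2 c, atlas c & dom c p;
  atlas_compatible : forall c d, atlas c -> atlas d -> compatible c d;
  atlas_maximal : forall c, is_chart c ->
    (forall d, atlas d -> compatible c d /\ compatible d c) -> atlas c }.

Section Maps.
Context {R : realType} {m k : nat} (M : manifold R m) (N : manifold R k).
Implicit Type f : points M -> points N.

Definition smooth_map f : Prop :=
  continuous f /\
  forall c d p, atlas c -> atlas d -> dom c p -> dom d (f p) ->
    exists g, local_rep c d f p g.

Definition immersion f : Prop :=
  forall c d p g, atlas c -> atlas d -> dom c p -> dom d (f p) ->
    local_rep c d f p g -> injective ('d g (coord c p)).

(* The last clause is the continuity of the inverse map on the image. *)
Definition embedding f : Prop :=
  [/\ smooth_map f, immersion f, injective f &
      forall A : set (points M), open A ->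
        exists2 B : set (points N), open B & f @` A = range f `&` B].

End Maps.

(* A 2-form is given by its components: [form_comp c p] is the matrix of the
   bilinear form on the tangent space at [p] in the basis provided by the chart
   [c].  Tangent vectors are rows, so that by [deriveEjacobian] a coordinate
   change [g] maps the row [v] to [v *m 'J g x].  The components are normalized
   to be zero where they have no meaning, so that equal forms are equal
   records. *)
Record symplectic_form {R : realType} {m : nat} (M : manifold R m) :=
  SymplecticForm {
  form_comp : chart R m (points M) -> points M -> 'M[R]_m;
  form_out : forall c p, ~ (atlas c /\ dom c p) -> form_comp c p = 0;
  form_skew : forall c p, (form_comp c p)^T = - form_comp c p;
  form_transform : forall c d p g, atlas c -> atlas d -> dom c p -> dom d p ->
    local_rep c d id p g ->
    form_comp c p =
      'J g (coord c p) *m form_comp d p *m ('J g (coord c p))^T;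
  form_smooth : forall c p, atlas c -> dom c p ->
    exists g, local_ext c setT p (form_comp c) g;
  form_closed : forall c p g, atlas c -> dom c p ->
    local_ext c setT p (form_comp c) g ->
    forall i j l : 'I_m,
      ('D_(delta_mx 0 i) g (coord c p)) j l +
      ('D_(delta_mx 0 j) g (coord c p)) l i +
      ('D_(delta_mx 0 l) g (coord c p)) i j = 0;
  form_nondegenerate : forall c p, atlas c -> dom c p ->
    form_comp c p \in unitmx }.

Section Scaling.
Context {R : realType} {m : nat}.

Lemma iter_partial_scale (V : normedModType R) (a : R) (W : set 'rV[R]_m)
    (g : 'rV[R]_m -> V) (s : seq 'I_m) : open W -> smooth_on W g ->
  forall x, W x -> iter_partial s (a \*: g) x = a *: iter_partial s g x.
Proof.
move=> oW sg; elim: s => [//|i s IHs] x Wx /=.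
have nW : \forall y \near x, W y by exact: open_nbhs_nbhs.
rewrite (@near_eq_derive _ _ _ _ (a \*: iter_partial s g)).
  by rewrite deriveZ //; apply: (sg s x Wx).2.
by near=> y; apply: IHs; near: y.
Unshelve. all: by end_near. Qed.

Lemma smooth_on_scale (V : normedModType R) (a : R) (W : set 'rV[R]_m)
    (g : 'rV[R]_m -> V) : open W -> smooth_on W g -> smooth_on W (a \*: g).
Proof.
move=> oW sg s x Wx.
have nW : \forall y \near x, W y by exact: open_nbhs_nbhs.
have E : \forall y \near x,
    (a \*: iter_partial s g) y = iter_partial s (a \*: g) y.
  by apply: filterS nW => y Wy; rewrite (iter_partial_scale a s oW sg).
have [cg dg] := sg s x Wx; split=> [|i].
  rewrite /prop_for /continuous_at (iter_partial_scale a s oW sg) //.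
  apply: (@cvg_trans _ ((a \*: iter_partial s g) @ x)).
    exact: near_eq_cvg E.
  exact: (cvgZl_tmp cg).
by apply: (near_eq_derivable E); exact/derivableZ/dg.
Unshelve. all: by end_near. Qed.

Lemma local_ext_scale (X : Type) (V : normedModType R) (c : chart R m X)
    (D : set X) (p : X) (f : X -> V) (g : 'rV[R]_m -> V) (a : R) :
  local_ext c D p f g -> local_ext c D p (a \*: f) (a \*: g).
Proof.
move=> [W [oW Wp sg fg]]; exists W; split=> //; first exact: smooth_on_scale.
by move=> q Dq cq Wq /=; rewrite fg.
Qed.

Variables (M : manifold R m) (a : R) (a_gt0 : 0 < a) (w : symplectic_form M).

Let comp c p := a *: form_comp w c p.

Let comp_out c p : ~ (atlas c /\ dom c p) -> comp c p = 0.
Proof. by move=> cp; rewrite /comp form_out ?scaler0. Qed.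

Let comp_skew c p : (comp c p)^T = - comp c p.
Proof. by rewrite /comp linearZ /= form_skew scalerN. Qed.

Let comp_transform c d p g : atlas c -> atlas d -> dom c p -> dom d p ->
  local_rep c d id p g ->
  comp c p = 'J g (coord c p) *m comp d p *m ('J g (coord c p))^T.
Proof.
move=> Ac Ad cp dp cdg.
by rewrite /comp (form_transform w Ac Ad cp dp cdg) -scalemxAr -scalemxAl.
Qed.

Let comp_smooth c p : atlas c -> dom c p ->
  exists g, local_ext c setT p (comp c) g.
Proof.
move=> Ac cp; have [g wg] := form_smooth w Ac cp.
by exists (a \*: g); exact: local_ext_scale.
Qed.

Let comp_closed c p g : atlas c -> dom c p -> local_ext c setT p (comp c) g ->
  forall i j l : 'I_m,
    ('D_(delta_mx 0 i) g (coord c p)) j l +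
    ('D_(delta_mx 0 j) g (coord c p)) l i +
    ('D_(delta_mx 0 l) g (coord c p)) i j = 0.
Proof.
move=> Ac cp wg i j l.
have ha : local_ext c setT p (form_comp w c) (a^-1 \*: g).
  have := local_ext_scale a^-1 wg; congr local_ext; apply/funext => q /=.
  by rewrite scalerA mulVf ?gt_eqF // scale1r.
have dg k : derivable g (coord c p) (delta_mx 0 k).
  by have [W [_ Wp sg _]] := wg; exact: (sg [::] _ Wp).2.
have E k x y : ('D_(delta_mx 0 k) (a^-1 \*: g) (coord c p)) x y =
    a^-1 * ('D_(delta_mx 0 k) g (coord c p)) x y.
  by rewrite (deriveZ a^-1 (dg k)) [LHS]mxE.
have F := form_closed Ac cp ha i j l.
apply: (mulfI (invr_neq0 (lt0r_neq0 a_gt0))).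
rewrite mulr0 2!mulrDr; apply: etrans F; apply/esym.
exact: (congr2 +%R (congr2 +%R (E i j l) (E j l i)) (E l i j)).
Qed.

Let comp_nondegenerate c p : atlas c -> dom c p -> comp c p \in unitmx.
Proof.
by move=> Ac cp; rewrite unitmxZ ?unitfE ?gt_eqF //; exact: form_nondegenerate.
Qed.

Definition scale_form : symplectic_form M :=
  SymplecticForm comp_out comp_skew comp_transform comp_smooth comp_closed
    comp_nondegenerate.

End Scaling.

Section Capacities.
Context {R : realType} {n : nat}.

(* The set O_0 of symplectic manifolds of dimension 2n whose underlying set is
   a subset of beth_1. *)
Record symp := Symp {
  symp_base :> manifold R (2 * n);
  symp_form : symplectic_form symp_base }.

Definition scale (a : R) (a_gt0 : 0 < a) (M : symp) : symp :=
  Symp (scale_form a_gt0 (symp_form M)).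

(* f^* omega_N = omega_M *)
Definition preserves_form (M N : symp) (f : points M -> points N) : Prop :=
  forall c d p g, atlas c -> atlas d -> dom c p -> dom d (f p) ->
    local_rep c d f p g ->
    form_comp (symp_form M) c p =
      'J g (coord c p) *m form_comp (symp_form N) d (f p)
        *m ('J g (coord c p))^T.

Definition symplectic_embedding (M N : symp) (f : points M -> points N) :
  Prop := embedding f /\ preserves_form f.

Definition generalized_capacity (c : symp -> \bar R) : Prop :=
  [/\ forall M, (0 <= c M)%E,
      forall (M N : symp) (f : points M -> points N), symplectic_embedding f ->
        (c M <= c N)%E &
      forall (a : R) (a_gt0 : 0 < a) M, c (scale a_gt0 M) = (a%:E * c M)%E].

(* The combining functions on [0, +oo]^l; for l = 0 the minimum is +oo and the
   maximum is 0. *)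
Definition min_coord (l : nat) (x : 'I_l -> \bar R) : \bar R :=
  \big[Order.min/+oo%E]_(i < l) x i.
Definition max_coord (l : nat) (x : 'I_l -> \bar R) : \bar R :=
  \big[Order.max/0%E]_(i < l) x i.

Definition min_max_combination (G : set (symp -> \bar R))
    (h : symp -> \bar R) : Prop :=
  exists (l : nat) (cs : 'I_l -> symp -> \bar R)
    (F : ('I_l -> \bar R) -> \bar R),
    [/\ forall i, G (cs i),
        F = @min_coord l \/ F = @max_coord l &
        forall M, h M = F (fun i => cs i M)].

Definition limit_min_max_generating (G : set (symp -> \bar R)) : Prop :=
  G `<=` generalized_capacity /\
  forall c, generalized_capacity c ->
    exists h : nat -> symp -> \bar R,
      (forall k, min_max_combination G (h k)) /\
      (forall M, (fun k => h k M) @ \oo --> c M).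

End Capacities.
Arguments symp R n : clear implicits.

(* Main.v *)
(* For an arbitrary symplectic manifold M, consider the set of areas r of doubly
   periodic maps of the plane into M whose area density is constant.  It grows
   along symplectic embeddings and is multiplied by a when the form is.

   Let M_w be the disjoint union of countably many copies of the torus
   R^(2n)/Z^(2n), the i-th one carrying w_i times the standard form.  Its areas
   contain every w_i.  Conversely, cutting the plane into small squares and
   lifting the vertices of the grid to R^(2n), the total area of a periodic map
   is w_i times the value of the standard form on two period vectors, so that
   every area is an integral multiple of some w_i.

   Associate to each set x of natural numbers an infinite set D_x of primes such
   that D_x and D_y have finite intersection when x <> y, and put w_p = 1/p for
   p in D_x and w_p = 1 otherwise.  If a > 0 and a w(x)_i is an area of M_w(y)
   for all i, then a = u/d for positive integers u and d, and for p > u in D_x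
   the number a/p is a multiple of a weight of y only if p is in D_y; hence
   x = y.  For a set I of sets of natural numbers, the supremum
   of the a such that, for some x in I, all the a w(x)_i are areas of M is a
   generalized capacity, which is at least 1 at M_w(x) if and only if x is in I.
   So there are more capacities than real numbers, whereas continuum many
   functions have only continuum many sequences of finite minima and maxima. *)
Require Import Defs.
From HB Require Import structures.
From mathcomp Require Import all_boot all_order all_algebra.
From mathcomp Require Import all_classical all_reals all_analysis.
From mathcomp Require Import ring lra zify.
(* [coord] denotes the coordinates of a chart, not [vector.coord]. *)
Import Defs.

Set Implicit Arguments.
Unset Strict Implicit.
Unset Printing Implicit Defensive.

Import Order.TTheory GRing.Theory Num.Theory numFieldNormedType.Exports.

Local Open Scope classical_set_scope.
Local Open Scope ring_scope.
Local Open Scope card_scope.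

(** * Strictly differentiable and smooth maps *)

Section MatrixNorm.
Context {R : realType}.

Lemma mx_entry_le (p q : nat) (A : 'M[R]_(p, q)) i j : `|A i j| <= `|A|.
Proof.
by rewrite [leRHS]/Num.Def.normr /= mx_normrE; apply/bigmax_geP; right; exists (i, j).
Qed.

Lemma mx_norm_le (p q : nat) (A : 'M[R]_(p, q)) (e : R) :
  0 <= e -> (forall i j, `|A i j| <= e) -> `|A| <= e.
Proof.
move=> e0 Ae; rewrite [leLHS]/Num.Def.normr /= mx_normrE.
by apply/bigmax_leP; split => // -[i j] _; exact: Ae.
Qed.

Lemma mx_norm_lt (p q : nat) (A : 'M[R]_(p, q)) (e : R) :
  0 < e -> (forall i j, `|A i j| < e) -> `|A| < e.
Proof.
move=> e0 Ae; rewrite [ltLHS]/Num.Def.normr /= mx_normrE.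
by apply/bigmax_ltP; split => // -[i j] _; exact: Ae.
Qed.

Lemma mulmx_norm_le (p q r : nat) (A : 'M[R]_(p, q)) (B : 'M[R]_(q, r)) :
  `|A *m B| <= q%:R * `|A| * `|B|.
Proof.
apply: mx_norm_le => [|i j]; first by rewrite !mulr_ge0.
rewrite mxE (le_trans (ler_norm_sum _ _ _)) //.
apply: (@le_trans _ _ (\sum_(k < q) `|A| * `|B|)).
  by apply: ler_sum => k _; rewrite normrM ler_pM ?mx_entry_le.
by rewrite sumr_const card_ord -mulrA mulr_natl.
Qed.

Lemma ord2P (b : 'I_2) : b = ord0 \/ b = ord_max.
Proof. by case: b => -[|[|//]] ?; [left|right]; apply/val_inj. Qed.

Lemma delta_mx_norm_le (p q : nat) (i : 'I_p) (j : 'I_q) :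
  `|delta_mx i j : 'M[R]_(p, q)| <= 1.
Proof.
by apply: mx_norm_le => // a b; rewrite mxE; case: (_ && _);
  rewrite ?normr1 ?normr0.
Qed.

End MatrixNorm.

Section NormNeighbourhoods.
Context {R : realType}.

Lemma near_normP (V : normedModType R) (x : V) (P : set V) :
  (\forall y \near x, P y) <->
  exists2 d, 0 < d & forall y, `|y - x| < d -> P y.
Proof.
split=> [/nbhs_normP[d /= d0 dP]|[d d0 dP]].
  by exists d => // y yd; apply: dP; rewrite /= distrC.
by apply/nbhs_normP; exists d => // y; rewrite /ball_ /mkset distrC; exact: dP.
Qed.

Lemma open_normP (V : normedModType R) (W : set V) :
  open W <->
  forall x, W x -> exists2 d, 0 < d & forall y, `|y - x| < d -> W y.
Proof.
rewrite openE; split=> [oW x Wx|oW x Wx]; first exact/near_normP/oW.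
exact/near_normP/oW.
Qed.

Lemma continuous_normP (V V' : normedModType R) (f : V -> V') (x : V) :
  {for x, continuous f} <->
  forall e, 0 < e -> exists2 d, 0 < d &
    forall y, `|y - x| < d -> `|f y - f x| < e.
Proof.
split=> [/cvgrPdist_lt cf e e0|cf].
  have /near_normP[d d0 fd] := cf e e0.
  by exists d => // y yd; rewrite distrC; exact: fd.
apply/cvgrPdist_lt => e e0; have [d d0 fd] := cf e e0.
by apply/near_normP; exists d => // y yd; rewrite distrC; exact: fd.
Qed.

Lemma differentiable_normP (V V' : normedModType R) (f : V -> V')
    (L : {linear V -> V'}) (x : V) : continuous L ->
  (forall e, 0 < e -> exists2 d, 0 < d &
    forall y, `|y| < d -> `|f (y + x) - f x - L y| <= e * `|y|) ->
  differentiable f x /\ 'd f x = L :> (V -> V').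
Proof.
move=> cL fL.
have E : f \o shift x = cst (f x) + L +o_ 0 id.
  apply/eqaddoP => _/posnumP[e] /=; have [d d0 fd] := fL e%:num [gt0 of e%:num].
  apply/near_normP; exists d => // y; rewrite subr0 => yd.
  by have := fd y yd; rewrite -addrA -opprD.
have D := diff_unique cL E.
by split=> //; apply/diff_locallyP; rewrite D.
Qed.

Lemma continuous_near_open (V V' : normedModType R) (f : V -> V') (x : V) W :
  {for x, continuous f} -> open W -> W (f x) -> \forall y \near x, W (f y).
Proof. by move=> cf oW Wx; apply: cf; exact: open_nbhs_nbhs. Qed.

Definition norm_ball (V : normedModType R) (x : V) (d : R) : set V :=
  [set y | `|y - x| < d].

Lemma open_norm_ball (V : normedModType R) (x : V) d : open (norm_ball x d).
Proof.
apply/open_normP => y yx; exists (d - `|y - x|); first by rewrite subr_gt0.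
move=> z zy; rewrite /norm_ball /mkset -(subrK y z) -addrA.
by rewrite (le_lt_trans (ler_normD _ _)) // -ltrBrDr.
Qed.

Lemma norm_ball_center (V : normedModType R) (x : V) d :
  0 < d -> norm_ball x d x.
Proof. by rewrite /norm_ball /mkset subrr normr0. Qed.

Lemma near_finite (V : normedModType R) (x : V) (I : finType)
    (P : I -> set V) : (forall i, \forall y \near x, P i y) ->
  \forall y \near x, forall i, P i y.
Proof. by move=> nP; apply: filter_forall => i; exact: nP. Qed.

Lemma near_and (V : normedModType R) (x : V) (P Q : set V) :
  (\forall y \near x, P y) -> (\forall y \near x, Q y) ->
  \forall y \near x, P y /\ Q y.
Proof. by move=> nP nQ; apply: filterI. Qed.

End NormNeighbourhoods.

(** * Strict differentiability: composition, uniqueness, Jacobians *)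

Section StrictDifferentiability.
Context {R : realType}.

(** Both points [y] and [z] move, so that the estimate also controls chords that avoid [x], such as
    the diagonals of small squares near [x]. Vectors are rows, so that [A] acts from the right. *)
Definition strict_diff (m k : nat) (f : 'rV[R]_m -> 'rV[R]_k) (x : 'rV[R]_m)
    (A : 'M[R]_(m, k)) : Prop :=
  forall e, 0 < e -> exists2 d, 0 < d & forall y z, `|y - x| < d ->
    `|z - x| < d -> `|f y - f z - (y - z) *m A| <= e * `|y - z|.

Lemma strict_diff_near (m k : nat) (f g : 'rV[R]_m -> 'rV[R]_k) x A :
  (\forall y \near x, f y = g y) -> strict_diff f x A -> strict_diff g x A.
Proof.
move=> /near_normP[r r0 fg] dfx e e0; have [d d0 fd] := dfx e e0.
exists (Num.min r d) => [|y z]; first by rewrite lt_min r0.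
rewrite !lt_min => /andP[yr yd] /andP[zr zd].
by rewrite -!fg //; exact: fd.
Qed.

Lemma strict_diff_continuous (m k : nat) (f : 'rV[R]_m -> 'rV[R]_k) x A :
  strict_diff f x A -> {for x, continuous f}.
Proof.
move=> dfx; have [d d0 fd] := dfx 1 ltr01.
(* With the error bound 1, [C] is a Lipschitz constant of [f] at [x]. *)
set C := 1 + m%:R * `|A|.
have C0 : 0 < C by rewrite ltr_pwDl // mulr_ge0.
apply/continuous_normP => e e0.
exists (Num.min d (e / C)) => [|y].
  by rewrite lt_min d0 divr_gt0.
rewrite lt_min => /andP[yd ye].
have := fd y x yd; rewrite subrr normr0 mul1r => /(_ d0) fyx.
apply: (@le_lt_trans _ _ (C * `|y - x|)); last first.
  by rewrite mulrC -ltr_pdivlMr.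
rewrite -(subrK ((y - x) *m A) (f y - f x)) (le_trans (ler_normD _ _)) //.
rewrite mulrDl mul1r lerD // (le_trans (mulmx_norm_le _ _)) //.
by rewrite -mulrA [X in _ * X]mulrC mulrA.
Qed.

Lemma strict_diff_comp (m k l : nat) (f : 'rV[R]_m -> 'rV[R]_k)
    (g : 'rV[R]_k -> 'rV[R]_l) x A B :
  strict_diff f x A -> strict_diff g (f x) B -> strict_diff (g \o f) x (A *m B).
Proof.
move=> dfx dgx e e0.
set C := 1 + m%:R * `|A|.
have C0 : 0 < C by rewrite ltr_pwDl // mulr_ge0.
set D := 1 + k%:R * `|B|.
have D0 : 0 < D by rewrite ltr_pwDl // mulr_ge0.
have [d1 d10 gd1] := dgx (e / 2 / C) (divr_gt0 (divr_gt0 e0 (ltr0n _ 2)) C0).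
(* [e2 <= 1] gives [f] the Lipschitz constant [C], and [e2 * D <= e / 2] bounds the error of [f]
   after it is carried through [B]. *)
pose e2 := Num.min 1 (e / 2 / D).
have e20 : 0 < e2 by rewrite lt_min ltr01 !divr_gt0.
have [d2 d20 fd2] := dfx e2 e20.
have /continuous_normP/(_ d1 d10)[d3 d30 fd3] := strict_diff_continuous dfx.
exists (Num.min d2 d3) => [|y z]; first by rewrite lt_min d20.
rewrite !lt_min => /andP[y2 y3] /andP[z2 z3] /=.
have fyz := fd2 y z y2 z2.
have fyz1 : `|f y - f z| <= C * `|y - z|.
  rewrite -(subrK ((y - z) *m A) (f y - f z)) (le_trans (ler_normD _ _)) //.
  rewrite mulrDl lerD // ?(le_trans fyz) ?ler_wpM2r ?ge_min ?lexx //.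
  by rewrite (le_trans (mulmx_norm_le _ _)) // -mulrA [X in _ * X]mulrC mulrA.
have gyz : `|g (f y) - g (f z) - (f y - f z) *m B| <= e / 2 * `|y - z|.
  apply: le_trans (gd1 (f y) (f z) _ _) _.
  - exact: fd3.
  - exact: fd3.
  by rewrite -mulrA ler_wpM2l ?divr_ge0 ?(ltW e0) // ler_pdivrMl.
have -> : g (f y) - g (f z) - (y - z) *m (A *m B) =
    g (f y) - g (f z) - (f y - f z) *m B + (f y - f z - (y - z) *m A) *m B.
  by rewrite (mulmxBl (f y - f z)) mulmxA addrA subrK.
rewrite (le_trans (ler_normD _ _)) // (splitr e) mulrDl lerD //.
apply: le_trans (mulmx_norm_le _ _) _.
apply: (@le_trans _ _ (D * (e2 * `|y - z|))).
  rewrite [k%:R * _]mulrC -mulrA [leRHS]mulrC ler_pM ?mulr_ge0 //.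
  by rewrite ler_wpDl.
rewrite mulrA ler_wpM2r // mulrC -ler_pdivlMr //.
by rewrite ge_min lexx orbT.
Qed.

Lemma strict_diff_affine (m k : nat) (x : 'rV[R]_m) (A : 'M[R]_(m, k)) c :
  strict_diff (fun y => y *m A + c) x A.
Proof.
move=> e e0; exists 1 => // y z _ _.
by rewrite opprD addrACA subrr addr0 mulmxBl subrr normr0 mulr_ge0 // ltW.
Qed.

Lemma strict_diff_linear (m k : nat) (x : 'rV[R]_m) (A : 'M[R]_(m, k)) :
  strict_diff (fun y => y *m A) x A.
Proof.
rewrite (_ : (fun _ => _) = fun y => y *m A + 0); first exact: strict_diff_affine.
by apply/funext => y; rewrite addr0.
Qed.

Lemma strict_diff_id (m : nat) (x : 'rV[R]_m) : strict_diff id x 1%:M.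
Proof.
rewrite (_ : id = fun y => y *m 1%:M); first exact: strict_diff_linear.
by apply/funext => y; rewrite mulmx1.
Qed.

(** Dividing the two expansions along [t *: delta_mx 0 i] by [t] bounds the difference of the [i]-th
    rows by every positive [e]. *)
Lemma strict_diff_unique (m k : nat) (f : 'rV[R]_m -> 'rV[R]_k) x A B :
  strict_diff f x A -> strict_diff f x B -> A = B.
Proof.
move=> dA dB; apply/row_matrixP => i; apply/eqP; rewrite -subr_eq0 -normr_le0.
apply/ler_addgt0Pr => e e0; rewrite add0r.
have [d1 d10 f1] := dA (e / 2) (divr_gt0 e0 (ltr0n _ 2)).
have [d2 d20 f2] := dB (e / 2) (divr_gt0 e0 (ltr0n _ 2)).
pose t := Num.min d1 d2 / 2.
have t0 : 0 < t by rewrite divr_gt0 // lt_min d10.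
have td : t < Num.min d1 d2 by rewrite ltr_pdivrMr // ltr_pMr ?ltr1n // lt_min d10.
move: td; rewrite lt_min => /andP[t1 t2].
pose y := x + t *: delta_mx 0 i.
have yx : y - x = t *: delta_mx 0 i by rewrite /y addrC addKr.
have nyx : `|y - x| <= t.
  rewrite yx normrZ gtr0_norm // ler_piMr ?(ltW t0) //.
  exact: delta_mx_norm_le.
have a1 := f1 y x (le_lt_trans nyx t1); rewrite subrr normr0 in a1.
have {}a1 := a1 d10.
have a2 := f2 y x (le_lt_trans nyx t2); rewrite subrr normr0 in a2.
have {}a2 := a2 d20.
have E : row i A - row i B = t^-1 *: ((f y - f x - (y - x) *m B)
    - (f y - f x - (y - x) *m A)).
  have -> : forall u v w : 'rV[R]_k, (u - v) - (u - w) = w - v.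
    by move=> u v w; rewrite opprB addrC addrA subrK.
  rewrite yx -!scalemxAl -!rowE -scalerBr scalerA.
  by rewrite mulVf ?scale1r ?gt_eqF.
rewrite E normrZ normfV gtr0_norm // ler_pdivrMl //.
rewrite (le_trans (ler_normB _ _)) // mulrC (splitr e) mulrDl.
by rewrite lerD //; [apply: le_trans a2 _|apply: le_trans a1 _];
  rewrite ler_wpM2l ?divr_ge0 ?(ltW e0).
Qed.

Lemma strict_diff_differentiable (m k : nat) (f : 'rV[R]_m -> 'rV[R]_k) x A :
  strict_diff f x A -> differentiable f x /\ 'J f x = A.
Proof.
move=> dfx.
have cA : continuous (mulmxr A : 'rV[R]_m -> 'rV[R]_k).
  move=> y; apply: (@strict_diff_continuous _ _ _ _ A).
  exact: strict_diff_linear.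
have [|df D] := differentiable_normP (f := f) (x := x) cA.
  move=> e e0; have [d d0 fd] := dfx e e0; exists d => // y yd.
  have := fd (y + x) x; rewrite addrK subrr normr0; exact.
split=> //.
by apply/matrixP => i j; rewrite /jacobian mxE D /= -rowE mxE.
Unshelve. all: by end_near. Qed.

End StrictDifferentiability.

(** * Smooth maps and their strict derivatives *)

Section Smoothness.
Context {R : realType} {m : nat}.
Implicit Types (W : set 'rV[R]_m) (i j : 'I_m).

Section Values.
Context {V : normedModType R}.
Implicit Types g h : 'rV[R]_m -> V.

Lemma smooth_on_subset W W' g : W' `<=` W -> smooth_on W g -> smooth_on W' g.
Proof. by move=> WW' sg s x /WW'; exact: sg. Qed.

Lemma smooth_on_continuous W g x : smooth_on W g -> W x ->
  {for x, continuous g}.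
Proof. by move=> sg Wx; exact: (sg [::] x Wx).1. Qed.

Lemma smooth_on_derivable W g x i : smooth_on W g -> W x ->
  derivable g x (delta_mx 0 i).
Proof. by move=> sg Wx; exact: (sg [::] x Wx).2. Qed.

Lemma smooth_on_partial W g i : smooth_on W g ->
  smooth_on W (fun x => 'D_(delta_mx 0 i) g x).
Proof.
by move=> sg s x Wx; have := sg (rcons s i) x Wx; rewrite /iter_partial foldr_rcons.
Qed.

Lemma open_near_eq W (T : Type) (g h : 'rV[R]_m -> T) x : open W -> W x ->
  (forall y, W y -> g y = h y) -> \forall y \near x, g y = h y.
Proof.
move=> oW Wx gh; have nW : \forall y \near x, W y by exact: open_nbhs_nbhs.
exact: filterS nW.
Qed.

(** A coinduction principle: a class of functions with continuity and first partial derivatives on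
    [W], stable under partial derivatives up to equality on [W], consists of smooth functions. It
    replaces inductions on the list of directions. *)
Lemma smooth_on_coind W (K : set ('rV[R]_m -> V)) : open W ->
  (forall h x, K h -> W x ->
    {for x, continuous h} /\ forall i, derivable h x (delta_mx 0 i)) ->
  (forall h i, K h ->
    exists2 h', K h' & forall x, W x -> 'D_(delta_mx 0 i) h x = h' x) ->
  forall h, K h -> smooth_on W h.
Proof.
move=> oW K1 KD h Kh s x Wx.
have [h' Kh' hh'] : exists2 h', K h' & forall y, W y -> iter_partial s h y = h' y.
  elim: s => [|i s [h1 Kh1 hh1]] /=; first by exists h.
  have [h2 Kh2 hh2] := KD h1 i Kh1; exists h2 => // y Wy.
  rewrite -hh2 //; apply: near_eq_derive.
  exact: open_near_eq hh1.
have [ch' dh'] := K1 h' x Kh' Wx.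
have E : \forall y \near x, h' y = iter_partial s h y.
  by apply: (@open_near_eq W) => // y Wy; rewrite hh'.
split=> [|i]; last exact: near_eq_derivable E (dh' i).
rewrite /prop_for /continuous_at hh' //.
by apply: cvg_trans ch'; exact: near_eq_cvg E.
Qed.

Lemma smooth_on_eq W g h : open W -> (forall x, W x -> g x = h x) ->
  smooth_on W g -> smooth_on W h.
Proof.
move=> oW gh sg.
pose K : set ('rV[R]_m -> V) :=
  [set h | exists2 g, smooth_on W g & forall x, W x -> g x = h x].
apply: (@smooth_on_coind W K) => //; last by exists g.
- move=> {g h gh sg} h x [g sg gh] Wx.
  have E : \forall y \near x, g y = h y by exact: open_near_eq gh.
  split=> [|i]; last exact/(near_eq_derivable E)/(smooth_on_derivable sg).
  rewrite /prop_for /continuous_at -gh //.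
  apply: cvg_trans (smooth_on_continuous sg Wx).
  exact: near_eq_cvg E.
- move=> {g h gh sg} h i [g sg gh].
  exists (fun x => 'D_(delta_mx 0 i) g x).
    by exists (fun x => 'D_(delta_mx 0 i) g x) => //; exact: smooth_on_partial.
  by move=> x Wx; apply: near_eq_derive; apply: (@open_near_eq W) => // y /gh.
Qed.

Lemma smooth_on_cst W (v : V) : open W -> smooth_on W (fun=> v).
Proof.
move=> oW; apply: (@smooth_on_coind W [set h | exists v, h = cst v]) => //.
- move=> _ x [u ->] _; split=> [|i]; last exact: derivable_cst.
  exact: cst_continuous.
- move=> _ i [u ->]; exists (cst 0); first by exists 0.
  by move=> x _; rewrite derive_cst.
- by exists v.
Qed.

End Values.

Lemma smooth_on_mxP W (p q : nat) (g : 'rV[R]_m -> 'M[R]_(p, q)) : open W ->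
  smooth_on W g <-> forall a b, smooth_on W (fun x => g x a b).
Proof.
move=> oW; split=> [sg a b|sg].
- apply: (@smooth_on_coind _ W [set h | exists2 g : 'rV[R]_m -> 'M[R]_(p, q),
      smooth_on W g & h = fun x => g x a b]) => //; last by exists g.
  + move=> _ x [f sf ->] Wx; split=> [|i].
      apply: (@continuous_comp _ _ _ f (fun A : 'M[R]_(p, q) => A a b)).
        exact: smooth_on_continuous Wx.
      exact: coord_continuous.
    by move: (smooth_on_derivable (i := i) sf Wx) => /derivable_mxP.
  + move=> _ i [f sf ->]; exists (fun x => ('D_(delta_mx 0 i) f x) a b).
      by exists (fun x => 'D_(delta_mx 0 i) f x); [exact: smooth_on_partial|].
    by move=> x Wx; rewrite (derive_mx (smooth_on_derivable sf Wx)) mxE.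
- apply: (@smooth_on_coind _ W [set f : 'rV[R]_m -> 'M[R]_(p, q) |
      forall a b, smooth_on W (fun x => f x a b)]) => //.
  + move=> f x sf Wx; split=> [|i]; last first.
      by apply/derivable_mxP => a b; exact: smooth_on_derivable Wx.
    apply/continuous_normP => e e0.
    have nr : \forall y \near x, forall a b, `|f y a b - f x a b| < e.
      apply: near_finite => a; apply: near_finite => b.
      have /continuous_normP/(_ e e0)[d d0 fd] :=
        smooth_on_continuous (sf a b) Wx.
      by apply/near_normP; exists d.
    move/near_normP : nr => [d d0 fd]; exists d => // y yd.
    by apply: mx_norm_lt => // a b; rewrite !mxE; exact: fd.
  + move=> f i sf; exists (fun x => 'D_(delta_mx 0 i) f x); last by [].
    move=> a b.
    have df x : W x -> derivable f x (delta_mx 0 i).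
      by move=> Wx; apply/derivable_mxP => c d; exact: smooth_on_derivable Wx.
    apply: (@smooth_on_eq _ W (fun x => 'D_(delta_mx 0 i) (fun y => f y a b) x)).
    * exact: oW.
    * by move=> x Wx; rewrite (derive_mx (df x Wx)) mxE.
    * exact: smooth_on_partial (sf a b).
Qed.

Lemma line_is_derive (V : normedModType R) (f : 'rV[R]_m -> V) p v (t : R) :
  derivable f (p + t *: v) v ->
  is_derive t 1 (fun s : R => f (p + s *: v)) ('D_v f (p + t *: v)).
Proof.
have E : (fun h : R => h^-1 *: (((fun s : R => f (p + s *: v)) \o shift t) (h *: 1)
      - f (p + t *: v))) =
    (fun h => h^-1 *: ((f \o shift (p + t *: v)) (h *: v) - f (p + t *: v))).
  apply/funext => h /=; congr (_ *: (f _ - _)).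
  by rewrite [h%:A]mulr1 scalerDl addrCA.
move=> df; split; first by rewrite /derivable E.
by rewrite /derive E.
Qed.

(** This is the mean value theorem on a segment in direction [i]. The order of [a] and [b] is left
    open because they will be coordinates of two arbitrary points. *)
Lemma partial_increment (f : 'rV[R]_m -> R) i (p : 'rV[R]_m) (c e a b : R) :
  (forall t, (a <= t <= b) || (b <= t <= a) ->
    derivable f (p + t *: delta_mx 0 i) (delta_mx 0 i) /\
    `|'D_(delta_mx 0 i) f (p + t *: delta_mx 0 i) - c| <= e) ->
  `|f (p + b *: delta_mx 0 i) - f (p + a *: delta_mx 0 i) - (b - a) * c|
    <= e * `|b - a|.
Proof.
wlog ab : a b / a <= b.
  move=> H Hf; case/orP: (le_total a b) => ab; first exact: H.
  have {}H := H b a ab; rewrite [`|b - a|]distrC.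
  have S (u v w : R) : `|u - v - w| = `|v - u - - w|.
    by rewrite -normrN; congr `|_|; ring.
  rewrite S -mulNr opprB.
  by apply: H => t; rewrite orbC; exact: Hf.
move=> Hf.
pose F t := f (p + t *: delta_mx 0 i).
pose dF t := 'D_(delta_mx 0 i) f (p + t *: delta_mx 0 i).
have dFt t : a <= t <= b -> is_derive t 1 F (dF t).
  by move=> tab; apply: line_is_derive; apply: (Hf _ _).1; rewrite tab.
have [||t tab E] := @MVT_segment R F dF a b ab.
- by move=> x /itvP xab; apply: dFt; rewrite !xab.
- apply: derivable_within_continuous => t; rewrite in_itv => /dFt[]; exact.
rewrite -/(F a) -/(F b) E mulrC -mulrBr normrM mulrC ler_wpM2r //.
by apply: (Hf _ _).2; move: tab; rewrite in_itv /= => ->.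
Qed.

(** Continuity of the partial derivatives gives the estimate: one passes from [z] to [y] by changing
    one coordinate at a time and applies the mean value theorem to each change. *)
Lemma smooth_increment W (f : 'rV[R]_m -> R) x (e : R) : open W ->
  smooth_on W f -> W x -> 0 < e -> exists2 d, 0 < d &
    forall y z, `|y - x| < d -> `|z - x| < d ->
    `|f y - f z - \sum_i (y - z) 0 i * 'D_(delta_mx 0 i) f x| <= e * `|y - z|.
Proof.
(* The error is shared by [m] increments; [m.+1] avoids a division by zero when [m = 0]. *)
move=> oW sf Wx e0; pose e' := e / m.+1%:R.
have e'0 : 0 < e' by rewrite divr_gt0.
have nW : \forall y \near x, W y by exact: open_nbhs_nbhs.
have nD : \forall y \near x, W y /\
    forall i, `|'D_(delta_mx 0 i) f y - 'D_(delta_mx 0 i) f x| < e'.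
  apply: near_and => //; apply: near_finite => i.
  have /continuous_normP/(_ e' e'0)[d d0 Dd] :=
    smooth_on_continuous (smooth_on_partial i sf) Wx.
  by apply/near_normP; exists d.
move/near_normP : nD => [d d0 Dd]; exists d => // y z yd zd.
(* The path from [z] to [y]: [mix k] has already received [k] coordinates of [y]. *)
pose mix (k : nat) : 'rV[R]_m := \row_i (if (i < k)%N then y 0 i else z 0 i).
have mixy : y = mix m by apply/rowP => i; rewrite mxE ltn_ord.
have mixz : z = mix 0%N by apply/rowP => i; rewrite mxE.
have T : f y - f z = \sum_(k < m) (f (mix k.+1) - f (mix k)).
  rewrite [in LHS]mixy [in LHS]mixz.
  by rewrite -(big_mkord xpredT (fun k => f (mix k.+1) - f (mix k))) telescope_sumr.
rewrite T -sumrB (le_trans (ler_norm_sum _ _ _)) //.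
apply: (@le_trans _ _ (\sum_(k < m) e' * `|y - z|)); last first.
  rewrite sumr_const card_ord -mulrnAl ler_wpM2r // /e' -mulr_natr mulrAC.
  by rewrite ler_pdivrMr // ler_wpM2l ?(ltW e0) // ler_nat.
apply: ler_sum => k _.
pose q : 'rV[R]_m := \row_i (if i == k then 0 else mix k 0 i).
have Eq (t : R) i : (q + t *: delta_mx 0 k) 0 i = if i == k then t else mix k 0 i.
  rewrite !mxE eqxx /=; case: eqP => _; first by rewrite mulr1 add0r.
  by rewrite mulr0 addr0.
have E1 : mix k.+1 = q + y 0 k *: delta_mx 0 k.
  apply/rowP => i; rewrite Eq; case: eqP => [->|/eqP ik]; rewrite !mxE ?ltnS ?leqnn //.
  by rewrite leq_eqVlt (inj_eq val_inj) (negbTE ik).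
have E0 : mix k = q + z 0 k *: delta_mx 0 k.
  by apply/rowP => i; rewrite Eq; case: eqP => [->|//]; rewrite !mxE ltnn.
rewrite E1 E0; have -> : (y - z) 0 k = y 0 k - z 0 k by rewrite !mxE.
apply: (@le_trans _ _ (e' * `|y 0 k - z 0 k|)); last first.
  rewrite ler_wpM2l ?(ltW e'0) // (le_trans _ (mx_entry_le _ 0 k)) //.
  by rewrite !mxE.
apply: partial_increment => t tyz.
(* Balls of the sup norm are boxes: each coordinate of the intermediate point is one of [y], one of
   [z], or lies between the two. *)
have td : `|(q + t *: delta_mx 0 k) - x| < d.
  apply: mx_norm_lt => // a i; rewrite ord1 [X in `|X|]mxE Eq [X in _ + X]mxE.
  have yi : `|y 0 i - x 0 i| < d.
    by apply: le_lt_trans yd; apply: le_trans (mx_entry_le _ 0 i); rewrite !mxE.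
  have zi : `|z 0 i - x 0 i| < d.
    by apply: le_lt_trans zd; apply: le_trans (mx_entry_le _ 0 i); rewrite !mxE.
  case: eqP => [ik|_]; last by rewrite mxE; case: ifP.
  subst i; move: yi zi tyz; rewrite !ltr_distl.
  by move=> /andP[? ?] /andP[? ?] /orP[]/andP[? ?]; apply/andP; split; lra.
have [Wt Dt] := Dd _ td.
by split; [exact: smooth_on_derivable Wt|exact/ltW].
Qed.

Lemma strict_diff_smooth W (k : nat) (g : 'rV[R]_m -> 'rV[R]_k) x : open W ->
  smooth_on W g -> W x ->
  strict_diff g x (\matrix_(i, j) 'D_(delta_mx 0 i) (fun y => g y 0 j) x).
Proof.
move=> oW /(smooth_on_mxP _ oW) sg Wx e e0.
pose P (j : 'I_k) y z := `|g y 0 j - g z 0 j - \sum_i (y - z) 0 i *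
  'D_(delta_mx 0 i) (fun y => g y 0 j) x| <= e * `|y - z|.
(* To intersect neighbourhoods over the finitely many [j], an estimate on a pair of points is
   phrased as a property of the point farther from [x]. *)
have [d d0 dP] : exists2 d, 0 < d & forall y, `|y - x| < d -> 
    forall (j : 'I_k) z, `|z - x| <= `|y - x| -> P j y z /\ P j z y.
  apply/near_normP; apply: near_finite => j; apply/near_normP.
  have [d d0 gd] := smooth_increment oW (sg 0 j) Wx e0.
  by exists d => // y yd z zd; split; apply: gd => //; exact: le_lt_trans zd yd.
exists d => // y z yd zd.
apply: mx_norm_le => [|a j]; first by rewrite mulr_ge0 ?(ltW e0).
rewrite ord1 !mxE.
have : P j y z.
  by case/orP: (le_total `|z - x| `|y - x|) => [/(dP y yd j)[]|/(dP z zd j)[]].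
rewrite /P; congr (`|_ - _| <= _).
by apply: eq_bigr => i _; rewrite !mxE.
Qed.

Lemma smooth_on_strict_diff W (k : nat) (g : 'rV[R]_m -> 'rV[R]_k) x : open W ->
  smooth_on W g -> W x -> strict_diff g x ('J g x).
Proof.
move=> oW sg Wx; have dg := strict_diff_smooth oW sg Wx.
by rewrite (strict_diff_differentiable dg).2.
Qed.

Lemma jacobian_partial W (k : nat) (g : 'rV[R]_m -> 'rV[R]_k) x i (j : 'I_k) : open W ->
  smooth_on W g -> W x -> 'J g x i j = 'D_(delta_mx 0 i) (fun y => g y 0 j) x.
Proof.
move=> oW sg Wx; have dg := strict_diff_smooth oW sg Wx.
by rewrite (strict_diff_differentiable dg).2 mxE.
Qed.

Lemma strict_diff_derive (k : nat) (g : 'rV[R]_m -> 'rV[R]_k) x A i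
    (j : 'I_k) : strict_diff g x A ->
  derivable (fun y => g y 0 j) x (delta_mx 0 i) /\
  'D_(delta_mx 0 i) (fun y => g y 0 j) x = A i j.
Proof.
move=> dg; have [df J] := strict_diff_differentiable dg.
have dgi : derivable g x (delta_mx 0 i) by exact: diff_derivable.
split; first by move/derivable_mxP : dgi; apply.
by have /rowP/(_ j) := derive_mx dgi; rewrite deriveEjacobian // J -rowE !mxE => ->.
Qed.

End Smoothness.

(** * Chain rule and closure properties of smooth maps *)

Section SmoothAlgebra.
Context {R : realType}.

Lemma smooth_comp_partial (m k : nat) (W : set 'rV[R]_m) (W' : set 'rV[R]_k)
    (h : 'rV[R]_k -> R) (phi : 'rV[R]_m -> 'rV[R]_k) x (i : 'I_m) :
  open W -> open W' -> smooth_on W' h -> smooth_on W phi -> W x -> W' (phi x) ->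
  derivable (h \o phi) x (delta_mx 0 i) /\
  'D_(delta_mx 0 i) (h \o phi) x =
    \sum_j 'D_(delta_mx 0 i) (fun y => phi y 0 j) x * 'D_(delta_mx 0 j) h (phi x).
Proof.
move=> oW oW' sh sphi Wx W'x.
pose H y : 'rV[R]_1 := \row_(_ < 1) h y.
have E : (fun y => H y 0 0) = h by apply/funext => y; rewrite mxE.
have sH : smooth_on W' H.
  apply/(smooth_on_mxP _ oW') => a b; rewrite !ord1 E; exact: sh.
have dH := strict_diff_smooth oW' sH W'x.
have dphi := strict_diff_smooth oW sphi Wx.
have [d1 d2] := strict_diff_derive i 0 (strict_diff_comp dphi dH).
have E' : (fun y => (H \o phi) y 0 0) = h \o phi by apply/funext => y; rewrite mxE.
move: d1 d2; rewrite E' => d1 ->; split=> //.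
by rewrite mxE; apply: eq_bigr => j _; rewrite !mxE E.
Qed.

Inductive smooth_algebra (m : nat) (W : set 'rV[R]_m) : ('rV[R]_m -> R) -> Prop :=
| SmoothGen f : smooth_on W f -> smooth_algebra W f
| SmoothComp k (W' : set 'rV[R]_k) h phi : open W' -> smooth_on W' h ->
    smooth_on W phi -> (forall x, W x -> W' (phi x)) ->
    smooth_algebra W (h \o phi)
| SmoothAdd f g : smooth_algebra W f -> smooth_algebra W g ->
    smooth_algebra W (f \+ g)
| SmoothMul f g : smooth_algebra W f -> smooth_algebra W g ->
    smooth_algebra W (f \* g).

Lemma smooth_algebra_sum (m : nat) (W : set 'rV[R]_m) (I : Type) (s : seq I)
    (F : I -> 'rV[R]_m -> R) : open W -> (forall i, smooth_algebra W (F i)) ->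
  smooth_algebra W (fun x => \sum_(i <- s) F i x).
Proof.
move=> oW sF; elim: s => [|i s IHs].
  rewrite (_ : (fun _ => _) = fun=> 0); first exact/SmoothGen/smooth_on_cst.
  by apply/funext => x; rewrite big_nil.
rewrite (_ : (fun _ => _) = F i \+ (fun x => \sum_(i <- s) F i x)).
  exact: SmoothAdd.
by apply/funext => x; rewrite big_cons.
Qed.

(* The algebra is stable under partial derivatives, by the chain and product
   rules, so that it consists of smooth functions. *)
Lemma smooth_algebraP (m : nat) (W : set 'rV[R]_m) f : open W ->
  smooth_algebra W f -> smooth_on W f.
Proof.
move=> oW; move: f.
have D f x : smooth_algebra W f -> W x ->
    {for x, continuous f} /\ forall i, derivable f x (delta_mx 0 i).
  move=> sf Wx; elim: sf => {f} [f sf|k W' h phi oW' sh sphi WW'|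
      f g _ [cf df] _ [cg dg]|f g _ [cf df] _ [cg dg]].
  - by split=> [|i]; [exact: smooth_on_continuous Wx|exact: smooth_on_derivable Wx].
  - split=> [|i].
      apply: continuous_comp; first exact: smooth_on_continuous Wx.
      by apply: (smooth_on_continuous sh); exact: WW'.
    by have [] := smooth_comp_partial i oW oW' sh sphi Wx (WW' _ Wx).
  - by split=> [|i]; [exact: continuousD|exact: derivableD].
  - by split=> [|i]; [exact: continuousM|exact: derivableM].
apply: (@smooth_on_coind _ _ _ W (smooth_algebra W)) => // f i.
elim=> {f} [f sf|k W' h phi oW' sh sphi WW'|f g sf [f' sf' ff'] sg [g' sg' gg']|
    f g sf [f' sf' ff'] sg [g' sg' gg']].
- by exists (fun x => 'D_(delta_mx 0 i) f x) => //;
    apply: SmoothGen; exact: smooth_on_partial.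
- exists (fun x => \sum_j 'D_(delta_mx 0 i) (fun y => phi y 0 j) x *
    ((fun z => 'D_(delta_mx 0 j) h z) \o phi) x).
    apply: smooth_algebra_sum => // j; apply: SmoothMul.
      apply: SmoothGen; apply: smooth_on_partial.
      by move/(smooth_on_mxP _ oW) : sphi; apply.
    exact: (SmoothComp oW' (smooth_on_partial j sh) sphi WW').
  by move=> x Wx; rewrite (smooth_comp_partial i oW oW' sh sphi Wx (WW' _ Wx)).2.
- exists (f' \+ g'); first exact: SmoothAdd.
  move=> x Wx; rewrite deriveD ?ff' ?gg' //; first exact: (D _ _ sf Wx).2.
  exact: (D _ _ sg Wx).2.
- exists ((f \* g') \+ (g \* f')).
    by apply: SmoothAdd; exact: SmoothMul.
  move=> x Wx; rewrite deriveM ?ff' ?gg' //; first exact: (D _ _ sf Wx).2.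
  exact: (D _ _ sg Wx).2.
Qed.

Lemma smooth_on_comp (m k l : nat) (W : set 'rV[R]_m) (W' : set 'rV[R]_k)
    (h : 'rV[R]_k -> 'rV[R]_l) (phi : 'rV[R]_m -> 'rV[R]_k) :
  open W -> open W' -> smooth_on W' h -> smooth_on W phi ->
  (forall x, W x -> W' (phi x)) -> smooth_on W (h \o phi).
Proof.
move=> oW oW' /(smooth_on_mxP _ oW') sh sphi WW'; apply/smooth_on_mxP => // a b.
exact: smooth_algebraP oW (SmoothComp oW' (sh a b) sphi WW').
Qed.

Lemma smooth_on_mulmx (m p q r : nat) (W : set 'rV[R]_m)
    (A : 'rV[R]_m -> 'M[R]_(p, q)) (B : 'rV[R]_m -> 'M[R]_(q, r)) :
  open W -> smooth_on W A -> smooth_on W B -> smooth_on W (fun x => A x *m B x).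
Proof.
move=> oW /(smooth_on_mxP _ oW) sA /(smooth_on_mxP _ oW) sB.
apply/smooth_on_mxP => // a b; apply: smooth_algebraP => //.
rewrite (_ : (fun _ => _) = fun x => \sum_j A x a j * B x j b).
  by apply: smooth_algebra_sum => // j; apply: SmoothMul; exact: SmoothGen.
by apply/funext => x; rewrite mxE.
Qed.

Lemma smooth_on_trmx (m p q : nat) (W : set 'rV[R]_m)
    (A : 'rV[R]_m -> 'M[R]_(p, q)) :
  open W -> smooth_on W A -> smooth_on W (fun x => (A x)^T).
Proof.
move=> oW /(smooth_on_mxP _ oW) sA; apply/smooth_on_mxP => // a b.
by rewrite (_ : (fun _ => _) = fun x => A x b a) //; apply/funext => x; rewrite mxE.
Qed.

Lemma smooth_on_jacobian (m k : nat) (W : set 'rV[R]_m)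
    (g : 'rV[R]_m -> 'rV[R]_k) :
  open W -> smooth_on W g -> smooth_on W (jacobian g).
Proof.
move=> oW sg; apply/smooth_on_mxP => // i j.
apply: (@smooth_on_eq _ _ _ W (fun x => 'D_(delta_mx 0 i) (fun y => g y 0 j) x)) => //.
  by move=> x Wx; rewrite (jacobian_partial _ _ oW sg Wx).
by apply: smooth_on_partial; move/(smooth_on_mxP _ oW) : sg; apply.
Qed.

(** The entries of an affine map, together with the constants, form a class stable under partial
    derivatives. *)
Lemma smooth_on_affine (m k : nat) (W : set 'rV[R]_m) (A : 'M[R]_(m, k)) b :
  open W -> smooth_on W (fun x => x *m A + b).
Proof.
move=> oW; have dA x : strict_diff (fun x => x *m A + b) x A.
  exact: strict_diff_affine.
pose K : set ('rV[R]_m -> R) :=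
  [set f | (exists j, f = fun x => (x *m A + b) 0 j) \/ exists c, f = cst c].
have KS : forall f, K f -> smooth_on W f.
  apply: smooth_on_coind => //.
  - move=> _ x [[j ->]|[c ->]] Wx; split=> [|i].
    + apply: (@continuous_comp 'rV[R]_m 'rV[R]_k R (fun x => x *m A + b)
          (fun v : 'rV[R]_k => v 0 j)).
        exact: strict_diff_continuous (dA x).
      exact: coord_continuous.
    + by have [] := strict_diff_derive i j (dA x).
    + exact: cst_continuous.
    + exact: derivable_cst.
  - move=> _ i [[j ->]|[c ->]].
    + exists (cst (A i j)); first by right; exists (A i j).
      by move=> x Wx; rewrite (strict_diff_derive i j (dA x)).2.
    + by exists (cst 0); [right; exists 0|move=> x _; rewrite derive_cst].
by apply/smooth_on_mxP => // a j; apply: KS; left; exists j; rewrite ord1.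
Unshelve. all: by end_near. Qed.

End SmoothAlgebra.

(** * Symmetry of second derivatives *)

Section MixedPartials.
Context {R : realType} {m : nat}.
Implicit Types (W : set 'rV[R]_m) (f : 'rV[R]_m -> R) (i j : 'I_m).

Lemma is_derive_translate f (w x v : 'rV[R]_m) : derivable f (x + w) v ->
  is_derive x v (fun y => f (y + w)) ('D_v f (x + w)).
Proof.
have E : (fun h : R => h^-1 *: (((fun y => f (y + w)) \o shift x) (h *: v)
      - f (x + w))) =
    (fun h => h^-1 *: ((f \o shift (x + w)) (h *: v) - f (x + w))).
  by apply/funext => h /=; rewrite addrA.
by move=> df; split; [rewrite /derivable E|rewrite /derive E].
Qed.

(** The second difference is the increment in direction [i] of [G], itself a difference of [f] in
    direction [j]. The partial derivative of [G] is an increment of a partial derivative of [f],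
    hence close to [h] times the second derivative. *)
Lemma second_difference W f x i j (e : R) : open W -> smooth_on W f -> W x ->
  0 < e -> exists2 d, 0 < d & forall h, 0 < h < d ->
  `|f (x + h *: delta_mx 0 i + h *: delta_mx 0 j) - f (x + h *: delta_mx 0 i)
    - (f (x + h *: delta_mx 0 j) - f x)
    - h ^+ 2 * 'D_(delta_mx 0 j) (fun y => 'D_(delta_mx 0 i) f y) x|
  <= e * h ^+ 2.
Proof.
move=> oW sf Wx e0.
have [d1 d10 D1] := smooth_increment oW (smooth_on_partial i sf) Wx e0.
have /open_normP/(_ x Wx)[d2 d20 D2] := oW.
exists (Num.min d1 d2 / 2) => [|h /andP[h0 hd]].
  by rewrite divr_gt0 // lt_min d10.
pose G y := f (y + h *: delta_mx 0 j) - f y.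
set c := 'D_(delta_mx 0 j) _ x in D1 *.
have near_x (t : R) : 0 <= t <= h ->
    `|x + t *: delta_mx 0 i - x| < Num.min d1 d2 /\
    `|x + t *: delta_mx 0 i + h *: delta_mx 0 j - x| < Num.min d1 d2.
  move=> /andP[t0 th].
  have ti : `|t *: (delta_mx 0 i : 'rV[R]_m)| <= h.
    by rewrite normrZ ger0_norm // (le_trans _ th) // ler_piMr // delta_mx_norm_le.
  have hj : `|h *: (delta_mx 0 j : 'rV[R]_m)| <= h.
    by rewrite normrZ gtr0_norm // ler_piMr ?(ltW h0) // delta_mx_norm_le.
  have h2 : h + h < Num.min d1 d2 by move: hd; rewrite ltr_pdivlMr // mulr_natr.
  have h1 : h < Num.min d1 d2 by apply: le_lt_trans h2; rewrite lerDl ltW.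
  split; first by rewrite addrC addKr; exact: le_lt_trans h1.
  rewrite -(addrA x) (addrC x) addrK; apply: le_lt_trans h2.
  by apply: le_trans (ler_normD _ _) _; rewrite lerD.
have := @partial_increment _ _ G i x (h * c) (e * h) 0 h _.
rewrite scale0r addr0 subr0 (gtr0_norm h0) (mulrA h h) -(mulrA e h h) -expr2; apply.
move=> t t0h; have {t0h}: 0 <= t <= h.
  by case/orP: t0h => // /andP[? ?]; apply/andP; split; lra.
move=> /near_x[]; rewrite !lt_min => /andP[t1 t2] /andP[t1' t2'].
have Wt := D2 _ t2; have Wt' := D2 _ t2'.
have dG : is_derive (x + t *: delta_mx 0 i) (delta_mx 0 i) G
    ('D_(delta_mx 0 i) f (x + t *: delta_mx 0 i + h *: delta_mx 0 j) -
      'D_(delta_mx 0 i) f (x + t *: delta_mx 0 i)).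
  apply: is_deriveB.
    by apply: is_derive_translate; exact: smooth_on_derivable sf Wt'.
  by apply: derivableP; exact: smooth_on_derivable sf Wt.
split; first exact: ex_derive.
rewrite derive_val; have := D1 _ _ t1' t1.
set y := _ + h *: _; set z := x + t *: _.
have yz : y - z = h *: delta_mx 0 j by rewrite /y addrC addKr.
rewrite yz (bigD1 j) //= big1 ?addr0 => [|k kj]; last first.
  by rewrite !mxE eqxx (negbTE kj) mulr0 mul0r.
rewrite !mxE !eqxx mulr1 => /le_trans; apply.
by rewrite normrZ gtr0_norm // ler_pM2l // ler_piMr ?(ltW h0) // delta_mx_norm_le.
Qed.

(** The second difference is symmetric in [i] and [j], and divided by [h ^+ 2] it approximates both
    mixed derivatives. *)
Lemma mixed_partials W f x i j : open W -> smooth_on W f -> W x ->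
  'D_(delta_mx 0 j) (fun y => 'D_(delta_mx 0 i) f y) x =
  'D_(delta_mx 0 i) (fun y => 'D_(delta_mx 0 j) f y) x.
Proof.
move=> oW sf Wx; apply/eqP; rewrite -subr_eq0 -normr_le0.
apply/ler_addgt0Pr => e e0; rewrite add0r.
have [d1 d10 D1] := second_difference i j oW sf Wx (divr_gt0 e0 (ltr0n _ 2)).
have [d2 d20 D2] := second_difference j i oW sf Wx (divr_gt0 e0 (ltr0n _ 2)).
pose h := Num.min d1 d2 / 2.
have h0 : 0 < h by rewrite divr_gt0 // lt_min d10.
have : h < Num.min d1 d2 by rewrite ltr_pdivrMr // ltr_pMr ?ltr1n // lt_min d10.
rewrite lt_min => /andP[h1 h2].
have := D1 h; rewrite h0 h1 => /(_ isT); have := D2 h; rewrite h0 h2 => /(_ isT).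
set a := 'D_(delta_mx 0 j) _ x; set b := 'D_(delta_mx 0 i) _ x.
rewrite (addrAC x (h *: delta_mx 0 j)).
set u := f (_ + _ + _); set v := f (x + h *: delta_mx 0 j).
set w := f (x + _); set z := f x => H1 H2.
have hh : 0 < h ^+ 2 by rewrite exprn_gt0.
rewrite -(ler_pM2r hh) -[in leLHS](ger0_norm (ltW hh)) -normrM.
have -> : (a - b) * h ^+ 2 = (u - v - (w - z) - h ^+ 2 * b) - (u - w - (v - z) - h ^+ 2 * a).
  by ring.
rewrite (splitr e) mulrDl; apply: le_trans (ler_normB _ _) _.
exact: lerD H1 H2.
Qed.

End MixedPartials.

(** * Areas of tori in symplectic manifolds *)

Section LocalRepresentatives.
Context {R : realType} {m : nat}.

Lemma open_preimage_in (k : nat) (W : set 'rV[R]_m) (W' : set 'rV[R]_k)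
    (g : 'rV[R]_m -> 'rV[R]_k) : open W -> open W' -> smooth_on W g ->
  open (W `&` g @^-1` W').
Proof.
move=> oW oW' sg; rewrite openE => x [Wx W'gx].
have nW : \forall y \near x, W y by exact: open_nbhs_nbhs.
have nW' : \forall y \near x, W' (g y).
  by apply: (smooth_on_continuous sg Wx); exact: open_nbhs_nbhs.
exact: (near_and nW nW').
Qed.

Lemma chart_halfspace (X : topologicalType) (c : chart R m X) q : is_chart c ->
  dom c q -> halfspace (coord c q).
Proof.
case=> oc _ _ imc cq; have [U _ UE] := imc _ oc (@subset_refl _ _).
have : (coord c @` dom c) (coord c q) by exists q.
by rewrite UE => -[].
Qed.

(** Chart images are only relatively open in the half-space. The set [U] turns membership in [A]
    into an open condition on coordinates, by which the domains of local extensions are shrunk. *)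
Lemma chart_open (X : topologicalType) (c : chart R m X) (A : set X) :
  is_chart c -> open A -> exists2 U : set 'rV[R]_m, open U &
    forall q, dom c q -> U (coord c q) <-> A q.
Proof.
move=> cc; have [oc ic _ imc] := cc => oA.
have [|U oU UE] := imc (dom c `&` A) (openI oc oA); first by move=> q [].
exists U => // q cq; split=> [Uq|Aq].
  have : (U `&` @halfspace R m) (coord c q).
    by split=> //; exact: chart_halfspace.
  rewrite -UE => -[q' [cq' Aq'] qq'].
  by rewrite -(ic _ _ _ _ qq') // inE.
have : (coord c @` (dom c `&` A)) (coord c q) by exists q.
by rewrite UE => -[].
Qed.

Lemma chart_continuous (X : topologicalType) (c : chart R m X) p :
  is_chart c -> dom c p -> {for p, continuous (coord c)}.
Proof.
move=> [oc _ cc _] cp; move: cc; rewrite continuous_open_subspace // => cc.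
by apply: cc; rewrite inE.
Qed.

Lemma chart_near (X : topologicalType) (c : chart R m X) p (W : set 'rV[R]_m) :
  is_chart c -> dom c p -> open W -> W (coord c p) ->
  exists2 B, open B /\ B p & forall q, B q -> dom c q /\ W (coord c q).
Proof.
move=> cc cp oW Wp.
have : \forall q \near p, dom c q /\ W (coord c q).
  apply: filterI; first by apply: open_nbhs_nbhs; split=> //; case: cc.
  by apply: (chart_continuous cc cp); exact: open_nbhs_nbhs.
by rewrite /prop_near1 nbhsE => -[B [oB Bp] BW]; exists B.
Qed.

(** The domain of [h \o g] is cut down by [U] to points where the intermediate chart [b] is defined,
    since only there does [g] represent the change of charts. *)
Lemma local_rep_comp (X : topologicalType) (c b d : chart R m X) p g h :
  is_chart c -> open (dom b) -> dom c p -> dom b p ->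
  local_rep c b id p g -> local_rep b d id p h -> local_rep c d id p (h \o g).
Proof.
move=> cc ob cp bp [W [oW Wp sg gE]] [W' [oW' Wp' sh hE]].
have [U oU UE] := chart_open cc ob.
have gp : g (coord c p) = coord b p by exact: gE.
exists ((W `&` U) `&` g @^-1` W'); split.
- apply: open_preimage_in => //; first exact: openI.
  by apply: smooth_on_subset sg => x [].
- by split; [split=> //; apply/UE|rewrite /preimage /mkset gp].
- apply: (smooth_on_comp (W' := W')) => //; last by move=> x [].
    by apply: open_preimage_in => //; [exact: openI|apply: smooth_on_subset sg => x []].
  by apply: smooth_on_subset sg => x [[]].
- move=> q dq cq [[Wq Uq] W'q] /=; have bq : dom b q by apply/UE.
  have gq : g (coord c q) = coord b q by exact: gE.
  by rewrite gq; apply: hE => //; rewrite -gq.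
Qed.

End LocalRepresentatives.

Section Periods.
Context {R : realType} {n : nat}.
Local Notation symp := (symp R n).

(* [r] is the area of a torus with constant area density.  Strict
   differentiability plays the role of C^1: it is a pointwise condition which
   yields locally uniform estimates and is preserved by smooth maps. *)
Definition torus_period (M : symp) (r : R) : Prop :=
  exists phi : 'rV[R]_2 -> points M,
    [/\ continuous phi,
        forall x k, phi (x + delta_mx 0 k) = phi x &
        forall x, exists c A, [/\ atlas c, dom c (phi x),
          strict_diff (coord c \o phi) x A &
          (A *m form_comp (symp_form M) c (phi x) *m A^T) ord0 ord_max = r]].

(** The map [phi] is composed with [f]. By the chain rule its derivative [A] is multiplied by the
    Jacobian of [f] in charts, and since [f] preserves the form the area density stays [r]. *)
Lemma torus_period_embedding (M N : symp) (f : points M -> points N) r :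
  symplectic_embedding f -> torus_period M r -> torus_period N r.
Proof.
move=> [[[cf sf] _ _ _] pf] [phi [cphi perphi phiE]].
exists (f \o phi); split=> [x|x k|x].
- by apply: continuous_comp; [exact: cphi|exact: cf].
- by rewrite /= perphi.
have [c [A [ac cx dA ArE]]] := phiE x.
have [d ad dx] := atlas_cover (f (phi x)).
have [g gE] := sf c d (phi x) ac ad cx dx.
exists d, (A *m 'J g (coord c (phi x))); split=> //; last first.
  by rewrite trmx_mul -!mulmxA mulmxA -ArE (pf _ _ _ _ ac ad cx dx gE) !mulmxA.
have [W [oW Wx sg WE]] := gE.
have dg := smooth_on_strict_diff oW sg Wx.
have := strict_diff_comp dA dg; apply: strict_diff_near.
have n1 : \forall y \near x, dom c (phi y).
  apply: (cphi x); apply: open_nbhs_nbhs; split=> //.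
  by case: (atlas_is_chart ac).
have n2 : \forall y \near x, dom d (f (phi y)).
  have cfphi : {for x, continuous (f \o phi)}.
    by apply: continuous_comp; [exact: cphi|exact: cf].
  apply: cfphi; apply: open_nbhs_nbhs; split=> //.
  by case: (atlas_is_chart ad).
have n3 : \forall y \near x, W ((coord c \o phi) y).
  by apply: (strict_diff_continuous dA); apply: open_nbhs_nbhs.
have := near_and n1 (near_and n2 n3); apply: filterS => y [cy [dy Wy]].
exact: WE.
Qed.

Lemma torus_period_scale (M : symp) (a : R) (a_gt0 : 0 < a) r :
  torus_period M r -> torus_period (scale a_gt0 M) (a * r).
Proof.
move=> [phi [cphi perphi phiE]]; exists phi; split=> // x.
have [c [A [ac cx dA ArE]]] := phiE x; exists c, A; split=> //=.
by rewrite -scalemxAr -scalemxAl mxE ArE.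
Qed.

Lemma torus_period_unscale (M : symp) (a : R) (a_gt0 : 0 < a) r :
  torus_period (scale a_gt0 M) (a * r) -> torus_period M r.
Proof.
move=> [phi [cphi perphi phiE]]; exists phi; split=> // x.
have [c [A [ac cx dA ArE]]] := phiE x; exists c, A; split=> //.
apply: (mulfI (lt0r_neq0 a_gt0)); rewrite -ArE /=.
by rewrite -scalemxAr -scalemxAl [RHS]mxE.
Qed.

End Periods.

(** * Manifolds whose transition maps are translations *)

Lemma mulmx_col_eq0 (R : pzRingType) (p q r : nat) (A : 'M[R]_(p, q))
    (B : 'M[R]_(q, r)) i j : (forall k, B k j = 0) -> (A *m B) i j = 0.
Proof. by move=> B0; rewrite mxE big1 // => k _; rewrite B0 mulr0. Qed.

Lemma scale_rearrange (R : comPzRingType) (u v w h k : R^o) :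
  (u * w) *: h + v *: (w *: k) = k * w * v + u * w * h :> R.
Proof. by rewrite /GRing.scale /=; ring. Qed.

(** The cancellation pattern of the six terms in the cyclic sum that expresses closedness of a
    2-form. *)
Lemma pairs_cancel (V : zmodType) (x y z x' y' z' : V) :
  x + x' = 0 -> y + y' = 0 -> z + z' = 0 ->
  (x + y') + (z + x') + (y + z') = 0.
Proof.
move=> /addr0_eq <- /addr0_eq <- /addr0_eq <-.
by rewrite [x - y + _]addrC subrKA addrC subrKA subrr.
Qed.

Section TranslationAtlas.
Context {R : realType} {m : nat} (X : small_space).
Local Notation chart := (chart R m (points X)).
Variable base : set chart.
Hypothesis base_chart : forall b, base b -> is_chart b.
Hypothesis base_image : forall b, base b -> open (coord b @` dom b).
Hypothesis base_cover : forall p, exists2 b, base b & dom b p.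
Hypothesis base_translation : forall b b' p, base b -> base b' ->
  dom b p -> dom b' p -> exists v, exists2 A, open A /\ A p &
    forall q, A q -> dom b q -> dom b' q -> coord b' q = coord b q + v.

Definition translation_atlas : set chart :=
  [set c | is_chart c /\ forall b, base b -> compatible c b /\ compatible b c].

Lemma base_compatible b b' : base b -> base b' -> compatible b b'.
Proof.
move=> Bb Bb' p bp b'p.
have [v [A [oA Ap] vE]] := base_translation Bb Bb' bp b'p.
have [U oU UE] := chart_open (base_chart Bb) oA.
exists (fun x => x *m 1%:M + v), U; split=> //.
- exact/UE.
- exact: smooth_on_affine.
- by move=> q b'q bq /(UE _ bq) Aq; rewrite mulmx1 -vE.
Qed.

Lemma base_sub_atlas b : base b -> translation_atlas b.
Proof.
by move=> Bb; split; [exact: base_chart|move=> b' Bb'; split; exact: base_compatible].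
Qed.

Lemma translation_atlas_compatible c d :
  translation_atlas c -> translation_atlas d -> compatible c d.
Proof.
move=> [cc cB] [dd dB] p cp dp; have [b Bb bp] := base_cover p.
have [g gE] := (cB b Bb).1 p cp bp; have [h hE] := (dB b Bb).2 p bp dp.
exists (h \o g); apply: (local_rep_comp cc _ cp bp gE hE).
by case: (base_chart Bb).
Qed.

Lemma translation_atlas_maximal c : is_chart c ->
  (forall d, translation_atlas d -> compatible c d /\ compatible d c) ->
  translation_atlas c.
Proof. by move=> cc cA; split=> // b Bb; apply: cA; exact: base_sub_atlas. Qed.

(** Fermat's criterion: steps of length [t] in both directions bound the derivative from both sides
    by an arbitrary [e]. *)
Lemma minimum_partial (f : 'rV[R]_m -> R) W x i : open W -> smooth_on W f ->
  W x -> (\forall y \near x, f x <= f y) -> 'D_(delta_mx 0 i) f x = 0.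
Proof.
move=> oW sf Wx /near_normP[d d0 fd]; apply/eqP; rewrite -normr_le0.
apply/ler_addgt0Pr => e e0; rewrite add0r.
have [d' d'0 fd'] := smooth_increment oW sf Wx e0.
pose t := Num.min d d' / 2.
have t0 : 0 < t by rewrite divr_gt0 // lt_min d0.
have : t < Num.min d d' by rewrite ltr_pdivrMr // ltr_pMr ?ltr1n // lt_min d0.
rewrite lt_min => /andP[td td'].
have key (s : R) : `|s| = t -> - (s * 'D_(delta_mx 0 i) f x) <= e * t.
  move=> st; pose y := x + s *: delta_mx 0 i.
  have yx : y - x = s *: delta_mx 0 i by rewrite /y addrC addKr.
  have nyx : `|y - x| <= t.
    by rewrite yx normrZ st ler_piMr ?(ltW t0) // delta_mx_norm_le.
  have := fd' y x (le_lt_trans nyx td'); rewrite subrr normr0 => /(_ d'0).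
  rewrite yx (bigD1 i) //= big1 ?addr0 => [|k ki]; last first.
    by rewrite !mxE eqxx (negbTE ki) mulr0 mul0r.
  rewrite !mxE !eqxx mulr1 -yx => /(le_trans (ler_norm _)) H.
  have fyx := fd y (le_lt_trans nyx td).
  have : e * `|y - x| <= e * t by rewrite ler_wpM2l ?(ltW e0).
  by lra.
have k1 := key t (gtr0_norm t0).
have k2 : t * 'D_(delta_mx 0 i) f x <= e * t.
  by have := key (- t); rewrite normrN mulNr opprK; apply; exact: gtr0_norm.
by rewrite ler_norml; apply/andP; split; rewrite -(ler_pM2l t0); lra.
Qed.

(* At a boundary point, the first coordinate of the chart, read in [base], would
   have a minimum and hence a vanishing differential. *)
Lemma translation_atlas_image c : translation_atlas c -> open (coord c @` dom c).
Proof.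
move=> [cc cB]; rewrite openE => x [p cp <-{x}].
have [oc ic _ imc] := cc.
have [U oU UE] := imc _ oc (@subset_refl _ _).
have Up : U (coord c p).
  by have : (coord c @` dom c) (coord c p) by [exists p|]; rewrite UE => -[].
(* Where the first coordinate is positive, the half-space is a neighbourhood of the point, so that
   relative openness is openness. *)
suff pos (i : 'I_m) : nat_of_ord i = 0%N -> 0 < coord c p 0 i.
  have nU : \forall y \near coord c p, U y by exact: open_nbhs_nbhs.
  have nH : \forall y \near coord c p, @halfspace R m y.
    apply: near_finite => i; have [i0|/eqP i0] := eqVneq (nat_of_ord i) 0%N; last first.
      by near=> y.
    apply/near_normP; exists (coord c p 0 i) => [|y yp _]; first exact: pos.
    have := le_lt_trans (mx_entry_le (y - coord c p) 0 i) yp.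
    by rewrite !mxE ltr_norml => /andP[]; lra.
  rewrite UE; exact: (near_and nU nH).
move=> i0; rewrite lt_neqAle (chart_halfspace cc cp i0) andbT.
apply/eqP => ci0.
have [b Bb bp] := base_cover p.
have [h hE] := (cB b Bb).1 p cp bp; have [g gE] := (cB b Bb).2 p bp cp.
have ob : open (dom b) by case: (base_chart Bb).
have [W [oW Wp sg WE]] := gE.
have [Wh [oWh Whp sh WhE]] := hE.
have hp : h (coord c p) = coord b p by exact: WhE.
have [Wgh [oWgh Wghp _ WghE]] := local_rep_comp cc ob cp bp hE gE.
have [V oV VE] := chart_open (base_chart Bb) oc.
have sgi : smooth_on W (fun x => g x 0 i) by move/(smooth_on_mxP _ oW) : sg; apply.
(* The image of [b] is a full neighbourhood, on which the [i]-th coordinate of [g] is nonnegative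
   near [coord b p], with value 0 at this point. *)
have Jg0 k : 'J g (coord b p) k i = 0.
  rewrite (jacobian_partial _ _ oW sg Wp).
  apply: (minimum_partial _ oW sgi Wp).
  have nV : \forall y \near coord b p, V y.
    by apply: open_nbhs_nbhs; split=> //; apply/VE.
  have nW : \forall y \near coord b p, W y by exact: open_nbhs_nbhs.
  have nb : \forall y \near coord b p, (coord b @` dom b) y.
    by apply: open_nbhs_nbhs; split; [exact: base_image|exists p].
  have := near_and nV (near_and nW nb); apply: filterS => y [Vy [Wy [q bq qy]]].
  subst y; have cq : dom c q by apply/VE.
  rewrite (WE p) // (WE q) //= -ci0; exact: chart_halfspace.
have dh := smooth_on_strict_diff oWh sh Whp.
rewrite -hp in Jg0 Wp.
have dg := smooth_on_strict_diff oW sg Wp.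
(* The composite [g \o h] is the identity on the image of [c], although the [i]-th column of its
   derivative vanishes. A step [t] into the half-space, with error bound 1/2, would give
   [t <= t / 2]. *)
have [d d0 dE] := strict_diff_comp dh dg (divr_gt0 ltr01 (ltr0n _ 2)).
have := near_and (open_nbhs_nbhs (conj oU Up)) (open_nbhs_nbhs (conj oWgh Wghp)).
move=> /near_normP[d' d'0 d'E].
pose t := Num.min d d' / 2.
have t0 : 0 < t by rewrite divr_gt0 // lt_min d0.
have : t < Num.min d d' by rewrite ltr_pdivrMr // ltr_pMr ?ltr1n // lt_min d0.
rewrite lt_min => /andP[td td'].
pose y := coord c p + t *: delta_mx 0 i.
have yx : y - coord c p = t *: delta_mx 0 i by rewrite /y addrC addKr.
have nyx : `|y - coord c p| <= t.
  by rewrite yx normrZ (gtr0_norm t0) ler_piMr ?(ltW t0) // delta_mx_norm_le.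
have [Uy Wghy] := d'E y (le_lt_trans nyx td').
have [q cq qy] : (coord c @` dom c) y.
  rewrite UE; split=> // k k0; have := chart_halfspace cc cp k0.
  rewrite !mxE => /le_trans; apply; rewrite lerDl mulr_ge0 ?(ltW t0) //.
have := dE y (coord c p) (le_lt_trans nyx td).
rewrite subrr normr0 => /(_ d0).
have -> : (g \o h) (coord c p) = coord c p by exact: WghE.
have -> : (g \o h) y = y by rewrite -qy; apply: WghE; rewrite ?qy.
have entry (A : 'M[R]_m) :
    (y - coord c p - (y - coord c p) *m A) 0 i = t - t * A i i.
  rewrite yx !mxE !eqxx mulr1; congr (_ - _); rewrite (bigD1 i) //= big1 ?addr0 => [|k ki].
    by rewrite !mxE !eqxx mulr1.
  by rewrite !mxE (negbTE ki) andbF mulr0 mul0r.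
move=> /(le_trans (mx_entry_le _ 0 i)); rewrite entry.
rewrite (mulmx_col_eq0 _ _ Jg0) mulr0 subr0 (gtr0_norm t0) => H {entry}.
have : 1 / 2 * `|y - coord c p| <= 1 / 2 * t by rewrite ler_wpM2l.
by lra.
Unshelve. all: by end_near. Qed.


(** The image of [c] being open, the relation [g' = g + v] holds on a full neighbourhood of
    [coord c p], and adding a constant does not change the derivative. *)
Lemma jacobian_image_eq c p (k : nat) (g g' : 'rV[R]_m -> 'rV[R]_k) v B A A' :
  translation_atlas c -> dom c p -> open B -> B p ->
  (forall q, dom c q -> B q -> g' (coord c q) = g (coord c q) + v) ->
  strict_diff g (coord c p) A -> strict_diff g' (coord c p) A' -> A = A'.
Proof.
move=> ac cp oB Bp gg' dg dg'.
have [U oU UE] := chart_open ac.1 oB.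
have nU : \forall y \near coord c p, U y.
  by apply: open_nbhs_nbhs; split=> //; apply/UE.
have ni : \forall y \near coord c p, (coord c @` dom c) y.
  by apply: open_nbhs_nbhs; split; [exact: translation_atlas_image|exists p].
apply: (strict_diff_unique _ dg').
apply: (@strict_diff_near _ _ _ (fun y => g y + v)).
  have := near_and nU ni; apply: filterS => y [Uy [q cq qy]].
  by subst y; rewrite gg' //; apply/UE.
move=> e e0; have [d d0 dE] := dg e e0; exists d => // y z yd zd.
by rewrite opprD addrACA subrr addr0; exact: dE.
Qed.

Lemma local_rep_strict_diff (Y : Type) (c : chart) (d : Defs.chart R m Y) f p g :
  local_rep c d f p g -> strict_diff g (coord c p) ('J g (coord c p)).
Proof. by move=> [W [oW Wp sg _]]; exact: smooth_on_strict_diff oW sg Wp. Qed.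

(** * The symplectic form that is locally constant in the base charts *)

Section ConstantForm.
Variable Om : points X -> 'M[R]_m.
Hypothesis Om_skew : forall p, (Om p)^T = - Om p.
Hypothesis Om_unit : forall p, Om p \in unitmx.
Hypothesis Om_locally_constant : forall p, exists2 A, open A /\ A p &
  forall q, A q -> Om q = Om p.

Definition transition_jacobian (c : chart) (p : points X) : set 'M[R]_m :=
  [set A | exists b g, [/\ base b, dom b p, local_rep c b id p g &
    A = 'J g (coord c p)]].

(** Near [p], two base charts differ by a translation, which the derivative does not see. *)
Lemma transition_jacobian_unique c p A A' : translation_atlas c -> dom c p ->
  transition_jacobian c p A -> transition_jacobian c p A' -> A = A'.
Proof.
move=> ac cp [b [g [Bb bp gE ->]]] [b' [g' [Bb' b'p gE' ->]]].
have [v [B [oB Bp] vE]] := base_translation Bb Bb' bp b'p.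
have dg := local_rep_strict_diff gE; have dg' := local_rep_strict_diff gE'.
have [W [oW Wp sg WE]] := gE; have [W' [oW' Wp' sg' WE']] := gE'.
have [cc _] := ac.
have ob : open (dom b) by case: (base_chart Bb).
have ob' : open (dom b') by case: (base_chart Bb').
have [B1 [oB1 B1p] B1E] := chart_near cc cp (openI oW oW') (conj Wp Wp').
have oB' : open (B `&` (dom b `&` dom b') `&` B1) by do 3! apply: openI => //.
apply: (jacobian_image_eq (v := v) ac cp oB' _ _ dg dg').
  by [].
move=> q cq [[Bq [bq b'q]] /B1E[_ [Wq W'q]]]; rewrite WE // WE' //=; exact: vE.
Qed.

(** [Om p] is meant as the matrix of the form in every base chart at [p]; the Jacobian of the change
    from [c] to a base chart carries it to [c]. On the domain of [c] such a Jacobian exists, so that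
    the default value of [xget] does not occur there. *)
Definition pulled_form (c : chart) (p : points X) : 'M[R]_m :=
  if `[< translation_atlas c /\ dom c p >] then
    let A := xget 0 (transition_jacobian c p) in A *m Om p *m A^T
  else 0.

Lemma pulled_formE c p b g : translation_atlas c -> dom c p -> base b ->
  dom b p -> local_rep c b id p g ->
  pulled_form c p = 'J g (coord c p) *m Om p *m ('J g (coord c p))^T.
Proof.
move=> ac cp Bb bp gE; rewrite /pulled_form asboolT //=.
have tg : transition_jacobian c p ('J g (coord c p)) by exists b, g.
case: xgetP => [A _ tA|/(_ ('J g (coord c p)))/(_ tg)//].
by rewrite (transition_jacobian_unique ac cp tA tg).
Qed.

Lemma pulled_form_out c p :
  ~ (translation_atlas c /\ dom c p) -> pulled_form c p = 0.
Proof. by move=> ncp; rewrite /pulled_form asboolF. Qed.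

Lemma pulled_form_skew c p : (pulled_form c p)^T = - pulled_form c p.
Proof.
rewrite /pulled_form; case: ifP => _; last by rewrite trmx0 oppr0.
by rewrite /= !trmx_mul trmxK Om_skew mulNmx mulmxN mulmxA.
Qed.

Lemma pulled_form_transform c d p g : translation_atlas c ->
  translation_atlas d -> dom c p -> dom d p -> local_rep c d id p g ->
  pulled_form c p =
    'J g (coord c p) *m pulled_form d p *m ('J g (coord c p))^T.
Proof.
move=> ac ad cp dp gE; have [b Bb bp] := base_cover p.
have [h hE] := (ad.2 b Bb).1 p dp bp.
have od : open (dom d) by have [[]] := ad.
have hgE := local_rep_comp ac.1 od cp dp gE hE.
rewrite (pulled_formE ac cp Bb bp hgE) (pulled_formE ad dp Bb bp hE).
have gp : g (coord c p) = coord d p by have [W [_ Wp _ ->]] := gE.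
have dh := local_rep_strict_diff hE; rewrite -gp in dh.
have := strict_diff_comp (local_rep_strict_diff gE) dh.
move=> /strict_diff_differentiable[_ ->].
by rewrite trmx_mul gp !mulmxA.
Qed.

Lemma pulled_form_nondegenerate c p : translation_atlas c -> dom c p ->
  pulled_form c p \in unitmx.
Proof.
move=> ac cp; have [b Bb bp] := base_cover p.
have [g gE] := (ac.2 b Bb).1 p cp bp; have [h hE] := (ac.2 b Bb).2 p bp cp.
rewrite (pulled_formE ac cp Bb bp gE).
have ob : open (dom b) by case: (base_chart Bb).
have [W [oW Wp sW WE]] := local_rep_comp ac.1 ob cp bp gE hE.
have gp : g (coord c p) = coord b p by have [W' [_ W'p _ ->]] := gE.
have dh := local_rep_strict_diff hE; rewrite -gp in dh.
have dhg := strict_diff_comp (local_rep_strict_diff gE) dh.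
have [B [oB Bp] BW] := chart_near ac.1 cp oW Wp.
have E : 'J g (coord c p) *m 'J h (g (coord c p)) = 1%:M.
  apply/esym; apply: (jacobian_image_eq (v := 0) ac cp oB Bp _ (strict_diff_id _) dhg).
  by move=> q cq /BW[_ Wq]; rewrite addr0 WE.
have [u1 _] := mulmx1_unit E.
by rewrite !unitmx_mul u1 unitmx_tr u1 Om_unit.
Qed.

(** One map [g] and one constant matrix describe the form at all points near [p], which allows
    differentiating it. *)
Lemma pulled_form_local c p : translation_atlas c -> dom c p ->
  exists (g : 'rV[R]_m -> 'rV[R]_m) W, [/\ open W, W (coord c p),
    smooth_on W g & forall q, dom c q -> W (coord c q) -> pulled_form c q =
    'J g (coord c q) *m Om p *m ('J g (coord c q))^T].
Proof.
move=> ac cp; have [b Bb bp] := base_cover p.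
have [g gE] := (ac.2 b Bb).1 p cp bp; have [W [oW Wp sg WE]] := gE.
have ob : open (dom b) by case: (base_chart Bb).
have [B [oB Bp] BE] := Om_locally_constant p.
have [U oU UE] := chart_open ac.1 (openI ob oB).
exists g, (W `&` U); split=> //.
- exact: openI.
- by split=> //; apply/UE.
- by apply: smooth_on_subset sg => x [].
move=> q cq [Wq Uq]; have [bq Bq] : (dom b `&` B) q by apply/UE.
have gqE : local_rep c b id q g by exists W.
by rewrite (pulled_formE ac cq Bb bq gqE) (BE q Bq).
Qed.

Lemma pulled_form_smooth c p : translation_atlas c -> dom c p ->
  exists g, local_ext c setT p (pulled_form c) g.
Proof.
move=> ac cp; have [g [W [oW Wp sg WE]]] := pulled_form_local ac cp.
exists (fun x => 'J g x *m Om p *m ('J g x)^T), W; split=> //.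
- have sJ := smooth_on_jacobian oW sg.
  have sJO := smooth_on_mulmx oW sJ (smooth_on_cst (Om p) oW).
  exact: smooth_on_mulmx oW sJO (smooth_on_trmx oW sJ).
- by move=> q _ cq Wq; rewrite WE.
Qed.

(** The derivative of [J Om J^T], with [Om] constant, is a sum of terms containing one second
    derivative of [g] each. In the cyclic sum they cancel in pairs, by symmetry of the second
    derivatives and skew-symmetry of [Om p]. *)
Lemma pulled_form_closed c p G : translation_atlas c -> dom c p ->
  local_ext c setT p (pulled_form c) G -> forall i j l : 'I_m,
    ('D_(delta_mx 0 i) G (coord c p)) j l +
    ('D_(delta_mx 0 j) G (coord c p)) l i +
    ('D_(delta_mx 0 l) G (coord c p)) i j = 0.
Proof.
move=> ac cp [W' [oW' W'p sG GE]].
have [g [W [oW Wp sg WE]]] := pulled_form_local ac cp.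
have GJ : \forall x \near coord c p,
    G x = 'J g x *m Om p *m ('J g x)^T /\ W x.
  have nW : \forall x \near coord c p, W x by exact: open_nbhs_nbhs.
  have nW' : \forall x \near coord c p, W' x by exact: open_nbhs_nbhs.
  have ni : \forall x \near coord c p, (coord c @` dom c) x.
    by apply: open_nbhs_nbhs; split; [exact: translation_atlas_image|exists p].
  have := near_and ni (near_and nW nW').
  apply: filterS => x [[q cq qx] [Wx W'x]].
  by subst x; rewrite GE // WE.
set x0 := coord c p in Wp W'p GJ *.
(* [P] gives the entries of the Jacobian of [g], [H] the second derivatives at [x0], and [Q] the
   bilinear form with matrix [Om p]. *)
pose P (l a : 'I_m) x := 'D_(delta_mx 0 l) (fun y => g y 0 a) x.
have sga a : smooth_on W (fun y => g y 0 a).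
  by move/(smooth_on_mxP _ oW) : sg; apply.
have sP l a : smooth_on W (P l a) by apply: smooth_on_partial; exact: sga.
have dP i l a : derivable (P l a) x0 (delta_mx 0 i).
  exact: smooth_on_derivable (sP l a) Wp.
pose H (i j a : 'I_m) := 'D_(delta_mx 0 i) (P j a) x0.
have Hsym i j a : H i j a = H j i a by exact: mixed_partials oW (sga a) Wp.
pose Q (u v : 'I_m -> R) := \sum_a \sum_b u a * Om p a b * v b.
have Qskew u v : Q u v + Q v u = 0.
  rewrite /Q [X in _ + X]exchange_big /= -big_split big1 //= => a _.
  rewrite -big_split big1 //= => b _.
  by have /matrixP/(_ b a) := Om_skew p; rewrite !mxE => ->; ring.
have DG i j l : ('D_(delta_mx 0 i) G x0) j l =
    Q (H i j) (P l ^~ x0) + Q (P j ^~ x0) (H i l).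
  have dG : derivable G x0 (delta_mx 0 i) by exact: smooth_on_derivable sG W'p.
  rewrite (derive_mx dG) mxE.
  have E : \forall x \near x0, G x j l =
      (\sum_(a < m) \sum_(b < m) (P j a * cst (Om p a b) * P l b)) x.
    apply: filterS GJ => x [-> Wx]; rewrite fct_sumE -mulmxA mxE.
    apply: eq_bigr => a _; rewrite fct_sumE [X in _ * X]mxE mulr_sumr.
    apply: eq_bigr => b _; rewrite [X in _ * (_ * X)]mxE mulrA.
    by rewrite !(jacobian_partial _ _ oW sg Wx).
  rewrite (near_eq_derive _ E).
  have dT a b : derivable (P j a * cst (Om p a b) * P l b) x0 (delta_mx 0 i).
    apply: derivableM => //; apply: derivableM => //; exact: derivable_cst.
  rewrite derive_sum => [|a]; last by apply: derivable_sum => b; exact: dT.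
  rewrite /Q -big_split; apply: eq_bigr => a _ /=.
  rewrite derive_sum => [|b]; last exact: dT.
  rewrite -big_split; apply: eq_bigr => b _ /=.
  rewrite deriveM //; last by apply: derivableM => //; exact: derivable_cst.
  rewrite deriveM // derive_cst scaler0 add0r -/(H i j a) -/(H i l b).
  rewrite -[(_ * _) x0]/(P j a x0 * Om p a b) -[cst _ _]/(Om p a b).
  exact: scale_rearrange.
move=> i j l.
apply: (etrans (congr2 +%R (congr2 +%R (DG i j l) (DG j l i)) (DG l i j))).
have -> : H l i = H i l by apply/funext => a; exact: Hsym.
have -> : H l j = H j l by apply/funext => a; exact: Hsym.
have -> : H j i = H i j by apply/funext => a; exact: Hsym.
exact: pairs_cancel.
Qed.

Definition translation_manifold
    (hX : hausdorff_space (points X)) (sX : @second_countable (points X)) :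
    manifold R m :=
  @Manifold R m X translation_atlas hX sX
    (fun c (ac : translation_atlas c) => ac.1)
    (fun p => let: ex_intro2 b Bb bp := base_cover p in
       ex_intro2 _ _ b (base_sub_atlas Bb) bp)
    translation_atlas_compatible translation_atlas_maximal.

Definition pulled_symplectic_form hX sX :
    symplectic_form (translation_manifold hX sX) :=
  @SymplecticForm R m (translation_manifold hX sX) pulled_form pulled_form_out
    pulled_form_skew pulled_form_transform pulled_form_smooth
    pulled_form_closed pulled_form_nondegenerate.

End ConstantForm.

End TranslationAtlas.

(** * Disjoint unions of tori *)

Lemma image_pickle_inj (T : countType) (A B : set T) :
  pickle @` A = pickle @` B -> A = B.
Proof.
have sub (C D : set T) : pickle @` C = pickle @` D -> C `<=` D.
  move=> CD t Ct; have : (pickle @` D) (pickle t) by rewrite -CD; exists t.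
  by move=> [s Ds /(pcan_inj pickleK) <-].
by move=> AB; apply/seteqP; split; exact: sub.
Qed.

Section TorusPoints.
Context {R : realType} {m : nat}.
Implicit Types (i j : nat) (x y v : 'rV[R]_m) (k : 'I_m).

Lemma rat_cut_inj (a b : R) :
  (forall q : rat, ratr q < a <-> ratr q < b) -> a = b.
Proof.
have lt (c d : R) : (forall q : rat, ratr q < c <-> ratr q < d) -> ~ c < d.
  move=> cd ltcd; have [q] := rat_in_itvoo ltcd.
  by rewrite in_itv /= => /andP[cq /cd]; rewrite ltNge (ltW cq).
move=> ab; have [ltab|ltba|//] := ltgtP a b; first by case: (lt a b).
by case: (lt b a) => // q; split=> /ab.
Qed.

Definition integral (v : 'rV[R]_m) : Prop := forall k, v 0 k \is a Num.int.

Lemma integralN v : integral v -> integral (- v).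
Proof. by move=> iv k; rewrite mxE rpredN. Qed.

Lemma integral_small v : integral v -> `|v| < 1 -> v = 0.
Proof.
move=> iv v1; apply/rowP => k; rewrite [RHS]mxE; apply/eqP.
have := le_lt_trans (mx_entry_le v 0 k) v1; have /intrP[z ->] := iv k.
by rewrite -intr_norm ltrz1 intr_eq0; lia.
Qed.

Definition fractional x : 'rV[R]_m := \row_k (x 0 k - (Num.floor (x 0 k))%:~R).

Lemma fractional_eq x y : fractional x = fractional y <-> integral (x - y).
Proof.
split=> [/rowP xy k|xy].
  have := xy k; rewrite !mxE => E; apply/intrP.
  exists (Num.floor (x 0 k) - Num.floor (y 0 k)).
  by rewrite intrB; lra.
apply/rowP => k; rewrite !mxE; have := xy k; rewrite !mxE => xyk.
have {1 2}-> : x 0 k = (x 0 k - y 0 k) + y 0 k by rewrite subrK.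
by rewrite floorDzr // intrD floorK // opprD addrACA subrr add0r.
Qed.

(* A point of the torus is coded by the number of its sheet and by the rational
   cuts of the coordinates of its representative in [0, 1)^m. *)
Definition torus_graph i x : set (nat + 'I_m * rat) :=
  [set t | match t with
    | inl j => j = i
    | inr kq => ratr kq.2 < fractional x 0 kq.1
    end].

Definition torus_code i x : set nat := pickle @` torus_graph i x.

Lemma torus_code_eq i j x y :
  torus_code i x = torus_code j y <-> i = j /\ integral (x - y).
Proof.
split=> [/image_pickle_inj E|[-> /fractional_eq xy]]; last first.
  by rewrite /torus_code /torus_graph xy.
split; first by have := congr1 (@^~ (inl i)) E => /= <-.
apply/fractional_eq; apply/rowP => k; apply: rat_cut_inj => q.
by have := congr1 (@^~ (inr (k, q))) E => /= ->.
Qed.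

Definition torus_carrier : set (set nat) :=
  [set torus_code ix.1 ix.2 | ix in [set: nat * 'rV[R]_m]].

Definition torus_point i x : set_type torus_carrier :=
  SigSub (mem_set (ex_intro2 _ _ (i, x) I erefl : torus_carrier (torus_code i x))).

Lemma torus_point_eq i j x y :
  torus_point i x = torus_point j y <-> i = j /\ integral (x - y).
Proof.
rewrite -torus_code_eq; split=> [/(congr1 val)//|E].
exact: val_inj.
Qed.

Lemma torus_point_surj p : exists i x, p = torus_point i x.
Proof.
have [[i x] _ ix] := set_valP p; exists i, x.
by apply: val_inj; rewrite -ix.
Qed.

(** The quotient topology from countably many copies of R^m. *)
Definition torus_opens : set (set (set_type torus_carrier)) :=
  [set U | forall i, open [set x | U (torus_point i x)]].

Lemma torus_opensT : torus_opens setT.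
Proof. by move=> i; exact: openT. Qed.

Lemma torus_opensI A B :
  torus_opens A -> torus_opens B -> torus_opens (A `&` B).
Proof. by move=> oA oB i; exact: openI (oA i) (oB i). Qed.

Lemma torus_opens_bigcup (I : Type) (F : I -> set (set_type torus_carrier)) :
  (forall a, torus_opens (F a)) -> torus_opens (\bigcup_a F a).
Proof.
move=> oF i; rewrite (_ : [set x | _] = \bigcup_a [set x | F a (torus_point i x)]).
  by apply: bigcup_open => a _; exact: oF.
by apply/seteqP; split=> x [a _ ax]; exists a.
Qed.

Definition torus_space : small_space :=
  SmallSpace torus_opensT torus_opensI torus_opens_bigcup.

Local Notation X := (points torus_space).
Definition proj i x : X := torus_point i x.

Lemma proj_eq i j x y : proj i x = proj j y <-> i = j /\ integral (x - y).
Proof. exact: torus_point_eq. Qed.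

Lemma proj_surj (p : X) : exists i x, p = proj i x.
Proof. exact: torus_point_surj. Qed.

Lemma open_torusP (U : set X) :
  open U <-> forall i, open [set x | U (proj i x)].
Proof. by []. Qed.

Lemma proj_continuous i : continuous (proj i).
Proof. by apply/continuousP => U /open_torusP; exact. Qed.

(** The preimage of the image is a union of integral translates of [W]. *)
Lemma proj_open i (W : set 'rV[R]_m) : open W -> open (proj i @` W).
Proof.
move=> oW; apply/open_torusP => j; apply/open_normP => x [y Wy /proj_eq[ij yx]].
have /open_normP/(_ y Wy)[d d0 dW] := oW.
exists d => // z zx; exists (z + (y - x)); last first.
  by apply/proj_eq; rewrite (addrC z) addrK.
by apply: dW; rewrite addrA (addrAC _ (- x)) addrK.
Qed.

Definition sheet (p : X) : nat := xget 0%N [set i | exists x, p = proj i x].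

Lemma sheetE i x : sheet (proj i x) = i.
Proof.
rewrite /sheet; case: xgetP => [j _ [y /proj_eq[]]//|/(_ i)/=].
by case; exists x.
Qed.

Lemma sheet_locally_constant p : exists2 A, open A /\ A p &
  forall q, A q -> sheet q = sheet p.
Proof.
have [i [x ->]] := proj_surj p.
exists (proj i @` setT); first by split; [exact/proj_open/openT|exists x].
by move=> _ [y _ <-]; rewrite !sheetE.
Qed.

Lemma torus_hausdorff : hausdorff_space X.
Proof.
rewrite open_hausdorff => p q pq.
have [i [x px]] := proj_surj p; have [j [y qy]] := proj_surj q; subst p q.
have [ij|ij] := eqVneq i j; last first.
  exists (proj i @` setT, proj j @` setT) => /=.
    by rewrite !inE; split; [exists x|exists y].
  split; [exact/proj_open/openT|exact/proj_open/openT|].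
  apply/eqP/seteqP; split=> // r [[x' _ <-] [y' _ /proj_eq[ji _]]].
  by rewrite ji eqxx in ij.
subst j; have /existsNP[k xyk] : ~ integral (x - y).
  by move=> xy; move/eqP : pq; apply; exact/proj_eq.
set t := (x - y) 0 k in xyk; pose fl := Num.floor t.
have /andP[flt tfl] := floor_itv t; rewrite -/fl intrD in flt tfl.
have flt' : fl%:~R < t.
  rewrite lt_neqAle flt andbT; apply/eqP => E; apply: xyk.
  by rewrite -E intr_int.
(* Half the distance from the nonintegral coordinate [t] of [x - y] to the nearest integer: moving
   both [x] and [y] by less than [d] keeps it strictly between [fl] and [fl + 1]. *)
pose d := Num.min (t - fl%:~R) (fl%:~R + 1 - t) / 2.
have d0 : 0 < d by rewrite divr_gt0 // lt_min !subr_gt0 flt' tfl.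
have : d * 2 <= Num.min (t - fl%:~R) (fl%:~R + 1 - t) by rewrite divfK.
rewrite le_min => /andP[d1 d2].
exists (proj i @` norm_ball x d, proj i @` norm_ball y d) => /=.
  by rewrite !inE; split; [exists x|exists y] => //; exact: norm_ball_center.
split; [exact/proj_open/open_norm_ball|exact/proj_open/open_norm_ball|].
apply/eqP/seteqP; split=> // r [[x' x'x <-] [y' y'y /proj_eq[_ /(_ k) yx]]].
have := le_lt_trans (mx_entry_le _ 0 k) x'x.
have := le_lt_trans (mx_entry_le _ 0 k) y'y.
move: flt' tfl d1 d2; rewrite /t !mxE !ltr_norml => f1 f2 d1 d2 /andP[b1 b2] /andP[a1 a2].
move: yx; rewrite !mxE => /intrP[z zE].
have z1 : fl%:~R < (- z)%:~R :> R by rewrite intrN -zE; lra.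
have z2 : (- z)%:~R < (fl + 1)%:~R :> R by rewrite intrN -zE intrD; lra.
by move: z1 z2; rewrite !ltr_int; clear; lia.
Qed.

Lemma torus_second_countable : @second_countable X.
Proof.
pose F (iqk : nat * 'rV[rat]_m * nat) : set X :=
  proj iqk.1.1 @` norm_ball (map_mx ratr iqk.1.2) iqk.2.+1%:R^-1.
exists (F @` setT).
  by apply: (card_le_trans (card_image_le _ _)); exact: countableP.
split=> [_ [[[i q] k] _ <-]|p A].
  exact/proj_open/open_norm_ball.
rewrite nbhsE => -[B [oB Bp] BA].
have [i [x px]] := proj_surj p; subst p.
have /open_normP/(_ x Bp)[d d0 dB] : open [set x | B (proj i x)] by move/open_torusP : oB.
(* A ball of radius [k.+1%:R^-1] that contains [x] lies within twice this radius of [x], hence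
   within [d]. *)
pose k := Num.truncn (2 / d).
have kd : k.+1%:R^-1 * 2 < d.
  rewrite mulrC ltr_pdivrMr // -ltr_pdivrMl // mulrC.
  exact: truncnS_gt.
have k0 : 0 < k.+1%:R^-1 :> R by rewrite invr_gt0.
have qx a : exists q : rat, `|x 0 a - ratr q| < k.+1%:R^-1.
  move: k0; move: (k.+1%:R^-1) => e e0.
  have [|q] := @rat_in_itvoo R (x 0 a - e) (x 0 a + e); first by lra.
  by rewrite in_itv /= => /andP[? ?]; exists q; rewrite ltr_norml; lra.
pose q : 'rV[rat]_m := \row_a sval (cid (qx a)).
have qE : `|x - map_mx ratr q| < k.+1%:R^-1.
  apply: mx_norm_lt => // a b; rewrite ord1 !mxE; exact: svalP (cid (qx b)).
exists (F (i, q, k)); first by split; [exists (i, q, k)|exists x].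
move=> _ [y yq <-]; apply: BA; apply: dB.
rewrite -(subrK (map_mx ratr q) y) -addrA (le_lt_trans (ler_normD _ _)) //.
rewrite (distrC _ x); apply: lt_le_trans (ltrD yq qE) _.
by move/ltW : kd; rewrite mulr_natr mulr2n.
Qed.

(** With radius 1/4, two points of the ball are less than 1 apart, so that they coincide when they
    have the same projection; the lift picked by [xget] is unique on the domain. *)
Definition torus_chart i (a : 'rV[R]_m) : chart R m X :=
  Chart (proj i @` norm_ball a 4^-1)
    (fun p => xget 0 [set x | norm_ball a 4^-1 x /\ p = proj i x]).

Lemma norm_ball_proj_inj i (a x y : 'rV[R]_m) :
  norm_ball a 4^-1 x -> norm_ball a 4^-1 y -> proj i x = proj i y -> x = y.
Proof.
move=> ax ay /proj_eq[_ xy]; apply/eqP; rewrite -subr_eq0; apply/eqP.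
apply: integral_small => //; rewrite -(subrK a x) -addrA.
rewrite (le_lt_trans (ler_normD _ _)) // (distrC a).
by apply: lt_trans (ltrD ax ay) _; lra.
Qed.

Lemma torus_chart_proj i (a x : 'rV[R]_m) : norm_ball a 4^-1 x ->
  coord (torus_chart i a) (proj i x) = x.
Proof.
move=> ax; rewrite /=; case: xgetP => [y _ [ay]|/(_ x) []//].
by move/esym/(norm_ball_proj_inj ay ax).
Qed.

(** Centres with coordinates at least 1 place the balls inside the half-space that serves as model;
    integral translation provides such a centre over every point. *)
Definition torus_base : set (chart R m X) :=
  [set c | exists i (a : 'rV[R]_m), (forall k, 1 <= a 0 k) /\ c = torus_chart i a].

Lemma torus_chart_image i (a : 'rV[R]_m) (A : set X) : A `<=` dom (torus_chart i a) ->
  coord (torus_chart i a) @` A =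
    [set x | A (proj i x)] `&` norm_ball a 4^-1.
Proof.
move=> Aa; apply/seteqP; split=> [x [p Ap <-]|x [Ax ax]].
  have [y ay yp] := Aa _ Ap; subst p.
  by rewrite torus_chart_proj //; split.
by exists (proj i x) => //; exact: torus_chart_proj.
Qed.

Lemma torus_chart_image_open c (A : set X) : torus_base c -> open A ->
  A `<=` dom c -> open (coord c @` A).
Proof.
move=> [i [a [_ ->]]] oA Ac; rewrite torus_chart_image //.
by apply: openI; [move/open_torusP : oA|exact: open_norm_ball].
Qed.

Lemma torus_chart_dom_open i (a : 'rV[R]_m) : open (dom (torus_chart i a)).
Proof. exact/proj_open/open_norm_ball. Qed.

Lemma torus_base_chart c : torus_base c -> is_chart c.
Proof.
move=> cB; have [i [a [a1 cE]]] := cB; split.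
- by rewrite cE; exact: torus_chart_dom_open.
- rewrite cE => p q; rewrite !inE => -[x ax <-] [y ay <-].
  by rewrite !torus_chart_proj // => ->.
- rewrite cE continuous_open_subspace; last exact: torus_chart_dom_open.
  move=> p; rewrite inE => -[x ax <-] W.
  rewrite torus_chart_proj // nbhsE => -[U [oU Ux] UW].
  have nU : nbhs (proj i x) (proj i @` (U `&` norm_ball a 4^-1)).
    apply: open_nbhs_nbhs; split; last by exists x.
    by apply: proj_open; apply: openI => //; exact: open_norm_ball.
  apply: filterS nU => _ [y [Uy ay] <-].
  by rewrite /preimage /mkset torus_chart_proj //; exact: UW.
- move=> A oA Ac; exists (coord c @` A); first exact: torus_chart_image_open.
  apply/seteqP; split=> x; last by case.
  move=> Ax; split=> // k _; move: Ax; rewrite cE in Ac *.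
  rewrite torus_chart_image // => -[_ ax].
  have := le_lt_trans (mx_entry_le _ 0 k) ax.
  by have := a1 k; rewrite !mxE ltr_norml => a1k /andP[]; lra.
Qed.

Lemma torus_base_image c : torus_base c -> open (coord c @` dom c).
Proof.
move=> cB; apply: torus_chart_image_open => //.
by have [i [a [_ ->]]] := cB; exact: torus_chart_dom_open.
Qed.

Lemma torus_base_proj i x : exists y c, [/\ proj i y = proj i x,
  c = torus_chart i y, torus_base c & dom c (proj i x)].
Proof.
pose y : 'rV[R]_m := \row_k (x 0 k - (Num.floor (x 0 k))%:~R + 1).
have yx : proj i y = proj i x.
  apply/proj_eq; split=> // k; rewrite !mxE; apply/intrP.
  by exists (1 - Num.floor (x 0 k)); rewrite intrB; lra.
exists y, (torus_chart i y); split=> //.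
  exists i, y; split=> // k; rewrite mxE lerDr subr_ge0.
  by have /andP[] := floor_itv (x 0 k).
by exists y => //; apply: norm_ball_center; lra.
Qed.

Lemma torus_base_cover p : exists2 c, torus_base c & dom c p.
Proof.
have [i [x ->]] := proj_surj p.
by have [y [c [_ _ cB cx]]] := torus_base_proj i x; exists c.
Qed.

(** The lifts [x] and [x'] of [p] differ by an integral vector. [A] collects the points whose lift
    in the first ball, shifted by this vector, lies in the second ball. *)
Lemma torus_base_translation b b' p : torus_base b -> torus_base b' ->
  dom b p -> dom b' p -> exists v, exists2 A, open A /\ A p &
    forall q, A q -> dom b q -> dom b' q -> coord b' q = coord b q + v.
Proof.
move=> [i [a [_ ->]]] [i' [a' [_ ->]]] [x ax xp] [x' ax' x'p].
have /proj_eq[ii' xx'] : proj i' x' = proj i x by rewrite xp.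
subst i'; exists (x' - x).
exists (proj i @` (norm_ball a 4^-1 `&` [set y | norm_ball a' 4^-1 (y + (x' - x))])).
  split; last first.
    by exists x => //; split=> //; rewrite /mkset addrC subrK.
  apply: proj_open; apply: openI; first exact: open_norm_ball.
  rewrite (_ : [set y | _] = norm_ball (a' - (x' - x)) 4^-1).
    exact: open_norm_ball.
  move: (x' - x) => v; apply/funext => y.
  by rewrite /norm_ball /mkset opprB addrA.
move=> _ [y [ay ay'] <-] _ _; rewrite [in RHS]torus_chart_proj //.
have -> : proj i y = proj i (y + (x' - x)).
  by apply/proj_eq; split=> //; rewrite opprD addrA subrr add0r; exact: integralN.
exact: torus_chart_proj.
Qed.

End TorusPoints.

(** * The model manifolds: tori with weighted standard forms *)

Section Model.
Context {R : realType} {n : nat}.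
Implicit Types w : nat -> R.

(* In the coordinates (x_1, y_1, ..., x_n, y_n), the form sum_i dx_i /\ dy_i. *)
Definition std_form : 'M[R]_(2 * n) := \matrix_(i, j)
  (if odd i then - (i == j.+1 :> nat)%:R else (j == i.+1 :> nat)%:R).

Lemma std_form_skew : std_form^T = - std_form.
Proof.
apply/matrixP => i j; rewrite !mxE.
case: ifP => oj; case: ifP => oi; rewrite ?opprK //.
- have -> : (j == i.+1 :> nat) = false by lia.
  have -> : (i == j.+1 :> nat) = false by lia.
  by rewrite oppr0.
- have -> : (j == i.+1 :> nat) = false by lia.
  have -> : (i == j.+1 :> nat) = false by lia.
  by rewrite oppr0.
Qed.

Lemma std_form_unit : std_form \in unitmx.
Proof.
suff /mulmx1_unit[] : std_form *m std_form^T = 1%:M by [].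
apply/matrixP => i k; rewrite !mxE.
(* [p] is the partner of [i] in its symplectic pair, the only column where row [i] of [std_form] is
   nonzero. *)
have [p [ltp pE]] : exists p : nat,
    (p < 2 * n)%N /\ (p = if odd i then i.-1 else i.+1 :> nat).
  by exists (if odd i then i.-1 else i.+1); have := ltn_ord i; case: ifP; lia.
rewrite (bigD1 (Ordinal ltp)) //= big1 ?addr0 => [|j jp]; rewrite !mxE /=.
  have [<-|ik] := eqVneq i k.
    move: pE; case: ifP => oi pE.
      have -> : (i == p.+1 :> nat) = true by lia.
      by rewrite mulrNN mulr1.
    by rewrite pE eqxx mulr1.
  have {}ik : (i : nat) <> k by move=> /val_inj/eqP; rewrite (negbTE ik).
  move: pE; case: ifP => oi; case: ifP => ok pE.
  - have -> : (k == p.+1 :> nat) = false by lia.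
    by rewrite oppr0 mulr0.
  - have -> : (p == k.+1 :> nat) = false by lia.
    by rewrite mulr0.
  - have -> : (k == p.+1 :> nat) = false by lia.
    by rewrite oppr0 mulr0.
  - have -> : (p == k.+1 :> nat) = false by lia.
    by rewrite mulr0.
have {}jp : (j : nat) <> p by move=> E; move/eqP : jp; apply; exact: val_inj.
move: pE; case: ifP => oi pE.
  have -> : (i == j.+1 :> nat) = false by lia.
  by rewrite oppr0 mul0r.
have -> : (j == i.+1 :> nat) = false by lia.
by rewrite mul0r.
Qed.

Lemma std_form_integral (u v : 'rV[R]_(2 * n)) : integral u -> integral v ->
  (u *m std_form *m v^T) 0 0 \is a Num.int.
Proof.
move=> iu iv; rewrite mxE rpred_sum // => a _; rewrite !mxE rpredM // rpred_sum // => b _.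
rewrite !mxE rpredM //; case: ifP => _; rewrite ?rpredN ?natr_int //.
Qed.

Definition sheet_form w (p : points (@torus_space R (2 * n))) :=
  w (sheet p) *: std_form.

Lemma sheet_form_skew w p : (sheet_form w p)^T = - sheet_form w p.
Proof. by rewrite /sheet_form linearZ /= std_form_skew scalerN. Qed.

Lemma sheet_form_unit w (w0 : forall i, 0 < w i) p : sheet_form w p \in unitmx.
Proof. by rewrite unitmxZ ?unitfE ?gt_eqF // std_form_unit. Qed.

Lemma sheet_form_locally_constant w p : exists2 A, open A /\ A p &
  forall q, A q -> sheet_form w q = sheet_form w p.
Proof.
have [A oA As] := sheet_locally_constant p.
by exists A => // q Aq; rewrite /sheet_form As.
Qed.

Definition model w (w0 : forall i, 0 < w i) : symp R n :=
  Symp (pulled_symplectic_form torus_base_chart torus_base_image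
    torus_base_cover torus_base_translation (sheet_form_skew w)
    (sheet_form_unit w0) (sheet_form_locally_constant w)
    torus_hausdorff torus_second_countable).

Variables (w : nat -> R) (w0 : forall i, 0 < w i).

Lemma model_atlas c : torus_base c -> @atlas _ _ (model w0) c.
Proof.
exact: (base_sub_atlas torus_base_chart torus_base_translation).
Qed.

Lemma model_form_base c p : torus_base c -> dom c p ->
  form_comp (symp_form (model w0)) c p = w (sheet p) *: std_form.
Proof.
move=> cB cp.
have idE : local_rep c c id p id.
  exists setT; split=> //; first exact: openT.
  rewrite (_ : id = fun x => x *m 1%:M + 0); last first.
    by apply/funext => x; rewrite mulmx1 addr0.
  exact/smooth_on_affine/openT.
have -> : form_comp (symp_form (model w0)) c p =
    'J id (coord c p) *m sheet_form w p *m ('J id (coord c p))^T.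
  have ac := base_sub_atlas torus_base_chart torus_base_translation cB.
  exact: (pulled_formE torus_base_chart torus_base_image torus_base_cover
    torus_base_translation _ ac cp cB cp idE).
have [_ ->] := strict_diff_differentiable (strict_diff_id (coord c p)).
by rewrite mul1mx trmx1 mulmx1.
Qed.

End Model.

(** * Areas in disjoint unions of tori *)

Section DiscreteArea.
Context {R : realType} {m : nat} (S : 'M[R]_m).
Hypothesis S_skew : S^T = - S.
Implicit Types u v x y : 'rV[R]_m.

Definition pairing u v : R := (u *m S *m v^T) 0 0.

Lemma pairingDl u u' v : pairing (u + u') v = pairing u v + pairing u' v.
Proof. by rewrite /pairing !mulmxDl mxE. Qed.

Lemma pairingDr u v v' : pairing u (v + v') = pairing u v + pairing u v'.
Proof. by rewrite /pairing linearD /= mulmxDr mxE. Qed.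

Lemma pairingNl u v : pairing (- u) v = - pairing u v.
Proof. by rewrite /pairing !mulNmx mxE. Qed.

Lemma pairingNr u v : pairing u (- v) = - pairing u v.
Proof. by rewrite /pairing linearN /= mulmxN mxE. Qed.

Lemma pairingZl a u v : pairing (a *: u) v = a * pairing u v.
Proof. by rewrite /pairing -!scalemxAl mxE. Qed.

Lemma pairingZr a u v : pairing u (a *: v) = a * pairing u v.
Proof. by rewrite /pairing linearZ /= -scalemxAr mxE. Qed.

Lemma pairingC u v : pairing u v = - pairing v u.
Proof.
rewrite /pairing -[in LHS](trmxK (u *m S *m v^T)) [LHS]mxE.
by rewrite !trmx_mul trmxK S_skew mulNmx mulmxN mulmxA mxE.
Qed.

Lemma pairingvv u : pairing u u = 0.
Proof. by have := pairingC u u; lra. Qed.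

Definition pairingE := (pairingDl, pairingDr, pairingNl, pairingNr).

Lemma pairing_norm_le u v : `|pairing u v| <= (m * m)%:R * `|S| * (`|u| * `|v|).
Proof.
rewrite (le_trans (mx_entry_le _ _ _)) //.
have vT : `|v^T| <= `|v|.
  by apply: mx_norm_le => // i j; rewrite mxE mx_entry_le.
apply: le_trans (mulmx_norm_le _ _) _.
apply: (@le_trans _ _ (m%:R * (m%:R * `|u| * `|S|) * `|v|)).
  by rewrite ler_pM ?mulr_ge0 // ler_wpM2l // mulmx_norm_le.
by rewrite natrM le_eqVlt; apply/orP; left; apply/eqP; ring.
Qed.

(* The contributions of the inner edges cancel. *)
Lemma grid_area (N : nat) (X : nat -> nat -> 'rV[R]_m) m1 m2 :
  (forall l, X N l = X 0%N l + m1) -> (forall k, X k N = X k 0%N + m2) ->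
  \sum_(k < N) \sum_(l < N)
    pairing (X k.+1 l.+1 - X k l) (X k l.+1 - X k.+1 l) = 2 * pairing m1 m2.
Proof.
move=> X1 X2.
(* [H] and [U] are twice the areas of the triangles spanned by the origin and an edge. Then [quad]
   is a discrete Stokes formula: the pairing of the diagonals is the sum over the boundary. *)
pose H k l := pairing (X k l) (X k.+1 l).
pose U k l := pairing (X k l) (X k l.+1).
have quad k l : pairing (X k.+1 l.+1 - X k l) (X k l.+1 - X k.+1 l) =
    (H k l - H k l.+1) + (U k.+1 l - U k l).
  rewrite /H /U !pairingE.
  rewrite (pairingC (X k.+1 l.+1) (X k l.+1)) (pairingC (X k.+1 l.+1) (X k.+1 l)).
  ring.
have tele (F : nat -> R) : \sum_(l < N) (F l.+1 - F l) = F N - F 0%N.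
  by rewrite -(big_mkord xpredT (fun l => F l.+1 - F l)) telescope_sumr.
have teleX (F : nat -> 'rV[R]_m) : \sum_(l < N) (F l.+1 - F l) = F N - F 0%N.
  by rewrite -(big_mkord xpredT (fun l => F l.+1 - F l)) telescope_sumr.
have sumr (u : 'rV[R]_m) (F : 'I_N -> 'rV[R]_m) :
    \sum_l pairing u (F l) = pairing u (\sum_l F l).
  elim/big_ind2: _ => [|a b c d -> ->|//].
    by rewrite /pairing trmx0 mulmx0 mxE.
  by rewrite pairingDr.
under eq_bigr do under eq_bigr do rewrite quad.
under eq_bigr do rewrite big_split /=.
rewrite big_split /= [X in _ + X]exchange_big /=.
(* Telescoping leaves two opposite sides of the grid, which differ by a period vector. *)
have -> : \sum_(k < N) \sum_(l < N) (H k l - H k l.+1) = pairing m1 m2.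
  rewrite (eq_bigr (fun k : 'I_N => - pairing m2 (X k.+1 0%N - X k 0%N))).
    rewrite sumrN sumr (teleX (X ^~ 0%N)) X1 addrC addKr -pairingC.
    by [].
  move=> k _; rewrite (eq_bigr (fun l : 'I_N => - (H k l.+1 - H k l))).
  2: by move=> l _; rewrite opprB.
  rewrite sumrN (tele (H k)) /H !X2 !pairingE pairingvv (pairingC _ m2).
  ring.
have -> : \sum_(l < N) \sum_(k < N) (U k.+1 l - U k l) = pairing m1 m2.
  rewrite (eq_bigr (fun l : 'I_N => pairing m1 (X 0%N l.+1 - X 0%N l))).
    by rewrite sumr (teleX (X 0%N)) X2 addrC addKr.
  move=> l _; rewrite (tele (U ^~ l)) /U !X1 !pairingE pairingvv (pairingC _ m1).
  ring.
ring.
Qed.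

End DiscreteArea.

(** * Total area of a periodic grid of small quadrilaterals *)

Section PeriodicGrid.
Context {R : realType} {n : nat}.
Local Notation X := (points (@torus_space R (2 * n))).
Local Notation V := 'rV[R]_(2 * n).
Local Notation om := (pairing (@std_form R n)).

(* The bounds 1/4 make the lifts of adjacent quadrilaterals agree, since an
   integral vector of norm less than 1 vanishes. *)
Definition small_quad (w : nat -> R) (s e : R) (p00 p10 p11 p01 : X) : Prop :=
  exists i (a b c d : V), [/\
    [/\ p00 = proj i a, p10 = proj i b, p11 = proj i c & p01 = proj i d],
    [/\ `|b - a| < 4^-1, `|c - b| < 4^-1, `|d - a| < 4^-1 & `|c - d| < 4^-1] &
    `|w i * (2^-1 * om (c - a) (d - b)) - s| <= e].

(** The lifted edges are shown to match and to be periodic, so that they sum to a lift of the whole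
    grid whose period vectors are integral. The discrete area formula then gives the total area, and
    the [N * N] errors add up. *)
Lemma periodic_grid_area (w : nat -> R) (N : nat) (psi : nat -> nat -> X)
    (s e : R) :
  (forall k l, psi (k + N)%N l = psi k l) ->
  (forall k l, psi k (l + N)%N = psi k l) ->
  (forall k l, small_quad w s e
    (psi k l) (psi k.+1 l) (psi k.+1 l.+1) (psi k l.+1)) ->
  exists z : int,
    `|w (sheet (psi 0%N 0%N)) * z%:~R - (N * N)%:R * s| <= (N * N)%:R * e.
Proof.
move=> perk perl quad.
(* [D] lists the two edges from a vertex and the diagonal, as displacements. They are valid from
   every lift of the vertex, since the lifts are integral translates of each other. *)
pose P (kl : nat * nat) (D : V * V * V) :=
    [/\ forall i x, psi kl.1 kl.2 = proj i x ->
          [/\ psi kl.1.+1 kl.2 = proj i (x + D.1.1),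
            psi kl.1 kl.2.+1 = proj i (x + D.1.2) &
            psi kl.1.+1 kl.2.+1 = proj i (x + D.2)],
        [/\ `|D.1.1| < 4^-1, `|D.1.2| < 4^-1, `|D.2 - D.1.1| < 4^-1 &
          `|D.2 - D.1.2| < 4^-1] &
        `|w (sheet (psi kl.1 kl.2)) * (2^-1 * om D.2 (D.1.2 - D.1.1)) - s| <= e].
have /boolp.choice[D DE] : forall kl, exists D, P kl D.
  case=> k l; rewrite /P /= {P}.
  have [i [a [b [c [d [[pa pb pc pd] [ab bc ad dc] area]]]]]] := quad k l.
  exists (b - a, d - a, c - a); split=> //.
  - move=> j x; rewrite pa => /proj_eq[ij ax].
    have lift y : proj i y = proj j (x + (y - a)).
      by apply/proj_eq; split=> //; 
      rewrite addrCA opprD addrA subrr add0r opprB.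
    by split; rewrite ?pb ?pc ?pd.
  - by split=> //; rewrite opprB addrA subrK.
  - by rewrite pa sheetE opprB addrA subrK.
have [i0 [x0 psi0]] := proj_surj (psi 0%N 0%N).
pose E k l := (D (k, l)).1.1; pose U k l := (D (k, l)).1.2; pose C k l := (D (k, l)).2.
have DL k l i x : psi k l = proj i x -> [/\ psi k.+1 l = proj i (x + E k l),
    psi k l.+1 = proj i (x + U k l) & psi k.+1 l.+1 = proj i (x + C k l)].
  by have [H _ _] := DE (k, l); exact: H.
have DS k l : [/\ `|E k l| < 4^-1, `|U k l| < 4^-1, `|C k l - E k l| < 4^-1 &
    `|C k l - U k l| < 4^-1] by have [_ H _] := DE (k, l).
have uniq (x u v : V) i j p : p = proj i (x + u) -> p = proj j (x + v) ->
    `|u - v| < 1 -> u = v.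
  move=> -> /proj_eq[_]; rewrite opprD addrACA subrr add0r => uv uv1.
  by apply/eqP; rewrite -subr_eq0; apply/eqP; exact: integral_small.
have norm2 (u v : V) : `|u| < 4^-1 -> `|v| < 4^-1 -> `|u - v| < 1.
  move=> u4 v4; apply: le_lt_trans (ler_normB _ _) _.
  by apply: lt_trans (ltrD u4 v4) _; lra.
(* Both sides lead to lifts of the same opposite vertex, and their difference
   [U k.+1 l - (C k l - E k l)] is too short to be a nonzero integral vector. *)
have EU k l : E k l + U k.+1 l = C k l.
  have [i [x px]] := proj_surj (psi k l).
  have [pE _ pC] := DL _ _ _ _ px; have [_ pU _] := DL _ _ _ _ pE.
  have [s1 s2 s3 s4] := DS k l; have [_ s2' _ _] := DS k.+1 l.
  rewrite -addrA in pU; apply: (uniq _ _ _ _ _ _ pU pC).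
  rewrite addrAC -(opprB (C k l)) addrC; exact: norm2.
have UE k l : U k l + E k l.+1 = C k l.
  have [i [x px]] := proj_surj (psi k l).
  have [_ pU pC] := DL _ _ _ _ px; have [pE _ _] := DL _ _ _ _ pU.
  have [s1 s2 s3 s4] := DS k l; have [s1' _ _ _] := DS k l.+1.
  rewrite -addrA in pE; apply: (uniq _ _ _ _ _ _ pE pC).
  rewrite addrAC -(opprB (C k l)) addrC; exact: norm2.
(* The lift itself need not be periodic, but its short displacements are determined by their
   projections and hence inherit the period. *)
have perE k l : E k (l + N)%N = E k l.
  have [i [x px]] := proj_surj (psi k l).
  have [pE _ _] := DL _ _ _ _ px.
  have := px; rewrite -perl => /DL[pE' _ _]; rewrite perl in pE'.
  have [s1 _ _ _] := DS k l; have [s1' _ _ _] := DS k (l + N)%N.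
  by apply: (uniq _ _ _ _ _ _ pE' pE); exact: norm2.
have perU k l : U (k + N)%N l = U k l.
  have [i [x px]] := proj_surj (psi k l).
  have [_ pU _] := DL _ _ _ _ px.
  have := px; rewrite -perk => /DL[_ pU' _]; rewrite perk in pU'.
  have [_ s2 _ _] := DS k l; have [_ s2' _ _] := DS (k + N)%N l.
  by apply: (uniq _ _ _ _ _ _ pU' pU); exact: norm2.
(* The lift follows the edges along the first axis, then along the second; [EU] and [UE] make it
   independent of the path. *)
pose Y k l : V := x0 + \sum_(i < k) E i 0%N + \sum_(j < l) U k j.
have YU k l : Y k l.+1 = Y k l + U k l by rewrite /Y big_ord_recr addrA.
have YE k l : Y k.+1 l = Y k l + E k l.
  elim: l => [|l IHl]; first by rewrite /Y !big_ord0 !addr0 big_ord_recr addrA.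
  by rewrite !YU IHl -!addrA EU UE.
have YL k l : psi k l = proj i0 (Y k l).
  elim: k => [|k IHk]; last by have [-> _ _] := DL _ _ _ _ IHk; rewrite YE.
  elim: l => [|l IHl]; first by rewrite /Y !big_ord0 !addr0.
  by have [_ -> _] := DL _ _ _ _ IHl; rewrite YU.
pose m1 := Y N 0%N - Y 0%N 0%N; pose m2 := Y 0%N N - Y 0%N 0%N.
have Y1 l : Y N l = Y 0%N l + m1.
  elim: l => [|l IHl]; first by rewrite /m1 addrC subrK.
  by rewrite !YU IHl -{1}[N]add0n perU addrAC.
have Y2 k : Y k N = Y k 0%N + m2.
  elim: k => [|k IHk]; first by rewrite /m2 addrC subrK.
  by rewrite !YE IHk -{1}[N]add0n perE addrAC.
have [z1 z1E] : exists z : int, om m1 m2 = z%:~R.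
  apply/intrP; apply: std_form_integral.
    have := perk 0%N 0%N; rewrite add0n !YL => /proj_eq[_]; exact.
  have := perl 0%N 0%N; rewrite add0n !YL => /proj_eq[_]; exact.
exists z1; rewrite YL sheetE.
have area := grid_area std_form_skew Y1 Y2.
have -> : w i0 * z1%:~R - (N * N)%:R * s = \sum_(k < N) \sum_(l < N)
    (w i0 * (2^-1 * om (C k l) (U k l - E k l)) - s).
  under [RHS]eq_bigr do rewrite sumrB.
  rewrite sumrB -z1E; congr (_ - _); last first.
    by rewrite !sumr_const !card_ord -mulrnA mulr_natl.
  under [RHS]eq_bigr do rewrite -!mulr_sumr.
  rewrite -!mulr_sumr; congr (_ * _).
  rewrite -[LHS](mulKf (x := 2)) ?pnatr_eq0 // -area; congr (_ * _).
  apply: eq_bigr => k _; apply: eq_bigr => l _; congr (om _ _).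
    by rewrite YU YE -(addrA (Y k l)) EU (addrC (Y k l)) addrK.
  by rewrite YU YE opprD addrACA subrr add0r.
apply: le_trans (ler_norm_sum _ _ _) _.
apply: (@le_trans _ _ (\sum_(k < N) \sum_(l < N) e)).
  apply: ler_sum => k _; apply: le_trans (ler_norm_sum _ _ _) _.
  apply: ler_sum => l _; have [_ _] := DE (k : nat, l : nat).
  by rewrite /= YL sheetE.
by rewrite !sumr_const !card_ord -mulrnA mulr_natl.
Qed.

End PeriodicGrid.

(** * Every area of a torus in a model is an integral multiple of a weight *)

Section ModelPeriods.
Context {R : realType} {n : nat}.
Local Notation X := (points (@torus_space R (2 * n))).
Local Notation V := 'rV[R]_(2 * n).
Local Notation om := (pairing (@std_form R n)).
Local Notation e0 := (delta_mx 0 ord0 : 'rV[R]_2).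
Local Notation e1 := (delta_mx 0 ord_max : 'rV[R]_2).

(** Up to errors of size [t * h], the diagonals of the image are [h *: (u0 + u1)] and
    [h *: (u1 - u0)] for the rows [u0], [u1] of [B]. Their pairing is [2 * h ^+ 2] times that of
    [u0] and [u1], whence the factor [2^-1]. The corner [p] may move near [x], as the compactness
    argument requires. *)
Lemma square_quad_area (F : 'rV[R]_2 -> V) (x : 'rV[R]_2) (B : 'M[R]_(2, 2 * n))
    (w e : R) : strict_diff F x B -> 0 < e -> 0 < w ->
  exists2 d, 0 < d & forall p h, 0 < h -> `|p - x| + h < d ->
    `|w * (2^-1 * om (F (p + h *: e0 + h *: e1) - F p)
                    (F (p + h *: e1) - F (p + h *: e0)))
      - w * (B *m std_form *m B^T) ord0 ord_max * h ^+ 2| <= e * h ^+ 2.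
Proof.
move=> dF e_gt0 w0.
pose K := (2 * n * (2 * n))%:R * `|@std_form R n|.
have K0 : 0 <= K by rewrite mulr_ge0.
(* [4 * |B|] comes from the two terms linear in the errors and 1 from the quadratic term, which
   [t <= 1] makes linear in [t]; the last summand makes [Q] positive. *)
pose Q := w * K * (4 * `|B| + 1) + 1.
have Q0 : 0 < Q.
  by rewrite ltr_wpDl // mulr_ge0 ?mulr_ge0 ?(ltW w0) // addr_ge0 // mulr_ge0.
pose t := Num.min 1 (e / Q).
have t0 : 0 < t by rewrite lt_min ltr01 divr_gt0.
have t1 : t <= 1 by rewrite ge_min lexx.
have tQ : t * Q <= e by rewrite -ler_pdivlMr // ge_min lexx orbT.
have [d d0 Fd] := dF t t0; exists d => // p h h0 ph.
have he k : `|h *: (delta_mx 0 k : 'rV[R]_2)| <= h.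
  by rewrite normrZ (gtr0_norm h0) ler_piMr ?(ltW h0) // delta_mx_norm_le.
have h01 (s : R) : `|s| = 1 -> `|h *: (e1 + s *: e0)| <= h.
  move=> s1; rewrite normrZ (gtr0_norm h0) ler_piMr ?(ltW h0) //.
  apply: mx_norm_le => // a b; rewrite !mxE.
  have [->|->] := ord2P b.
    by rewrite !ord1 /= mulr1 add0r s1.
  by rewrite !ord1 /= mulr0 addr0 normr1.
have nearp (v : 'rV[R]_2) : `|v| <= h -> `|p + v - x| < d.
  move=> vh; rewrite addrAC; apply: le_lt_trans (ler_normD _ _) _.
  by apply: le_lt_trans ph; rewrite lerD2l.
pose u0 := row ord0 B; pose u1 := row ord_max B.
have E0 : e0 *m B = u0 by rewrite /u0 rowE.
have E1 : e1 *m B = u1 by rewrite /u1 rowE.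
have nu0 : `|u0| <= `|B| by apply: mx_norm_le => // a b; rewrite mxE mx_entry_le.
have nu1 : `|u1| <= `|B| by apply: mx_norm_le => // a b; rewrite mxE mx_entry_le.
have px : `|p - x| < d by apply: le_lt_trans ph; rewrite lerDl ltW.
have [eps1 F1 n1] : exists2 eps1, F (p + h *: e0 + h *: e1) - F p =
    h *: (u0 + u1) + eps1 & `|eps1| <= t * h.
  exists (F (p + h *: e0 + h *: e1) - F p - h *: (u0 + u1)).
    by rewrite [RHS]addrC subrK.
  have v01 : h *: e0 + h *: e1 = h *: (e1 + 1 *: e0).
    by rewrite scale1r scalerDr addrC.
  have := Fd (p + h *: e0 + h *: e1) p _ px.
  rewrite -(addrA p) v01 => /(_ (nearp _ (h01 1 (normr1 _)))).
  rewrite (addrC p) addrK -scalemxAl mulmxDl -scalemxAl E0 E1 !scale1r (addrC u1).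
  move=> /le_trans; apply; rewrite ler_wpM2l ?(ltW t0) //.
  by rewrite -[e0]scale1r h01 ?normr1.
have [eps2 F2 n2] : exists2 eps2, F (p + h *: e1) - F (p + h *: e0) =
    h *: (u1 - u0) + eps2 & `|eps2| <= t * h.
  exists (F (p + h *: e1) - F (p + h *: e0) - h *: (u1 - u0)).
    by rewrite [RHS]addrC subrK.
  have := Fd (p + h *: e1) (p + h *: e0) (nearp _ (he _)) (nearp _ (he _)).
  rewrite opprD addrACA subrr add0r -scalerBr -scalemxAl mulmxBl E0 E1.
  move=> /le_trans; apply; rewrite ler_wpM2l ?(ltW t0) //.
  by rewrite -scaleN1r h01 // normrN1.
have EB : (B *m std_form *m B^T) ord0 ord_max = om u0 u1.
  rewrite /pairing /u0 /u1 tr_row -row_mul !mxE; apply: eq_bigr => k _.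
  by rewrite !mxE.
have omu : om (u0 + u1) (u1 - u0) = 2 * om u0 u1.
  rewrite !pairingE !(pairingvv std_form_skew) (pairingC std_form_skew u1 u0).
  ring.
rewrite EB F1 F2.
have -> : w * (2^-1 * om (h *: (u0 + u1) + eps1) (h *: (u1 - u0) + eps2)) -
    w * om u0 u1 * h ^+ 2 = w * (2^-1 * (h * om (u0 + u1) eps2 +
      h * om eps1 (u1 - u0) + om eps1 eps2)).
  move: omu; move: (u0 + u1) (u1 - u0) => P D omu.
  rewrite pairingDl !pairingDr !pairingZl !pairingZr omu.
  by field.
have n01 : `|u0 + u1| <= 2 * `|B|.
  by apply: le_trans (ler_normD _ _) _; rewrite mulr2n mulrDl mul1r lerD.
have n10 : `|u1 - u0| <= 2 * `|B|.
  by apply: le_trans (ler_normB _ _) _; rewrite mulr2n mulrDl mul1r lerD.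
have om1 : `|om (u0 + u1) eps2| <= K * (2 * `|B| * (t * h)).
  by apply: le_trans (pairing_norm_le _ _ _) _; rewrite ler_wpM2l // ler_pM.
have om2 : `|om eps1 (u1 - u0)| <= K * ((t * h) * (2 * `|B|)).
  by apply: le_trans (pairing_norm_le _ _ _) _; rewrite ler_wpM2l // ler_pM.
have om3 : `|om eps1 eps2| <= K * (t * h * (t * h)).
  by apply: le_trans (pairing_norm_le _ _ _) _; rewrite ler_wpM2l // ler_pM.
have th : t * h * (t * h) <= t * h * h.
  by rewrite ler_wpM2l ?mulr_ge0 ?(ltW t0) ?(ltW h0) // ler_piMl // ltW.
have {th} om3' : `|om eps1 eps2| <= K * (t * h * h).
  by apply: le_trans om3 _; rewrite ler_wpM2l.
rewrite normrM (gtr0_norm w0) normrM gtr0_norm ?invr_gt0 //.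
apply: (@le_trans _ _ (w * (K * (4 * `|B| + 1) * t * h ^+ 2))).
  rewrite ler_wpM2l ?(ltW w0) //.
  apply: (@le_trans _ _ (2^-1 * (h * (K * (2 * `|B| * (t * h))) +
      h * (K * ((t * h) * (2 * `|B|))) + K * (t * h * h)))).
    rewrite ler_wpM2l ?invr_ge0 //; apply: le_trans (ler_normD _ _) _.
    rewrite lerD //; apply: le_trans (ler_normD _ _) _.
    by rewrite !normrM (gtr0_norm h0) lerD // ler_wpM2l // ltW.
  have -> : 2^-1 * (h * (K * (2 * `|B| * (t * h))) +
      h * (K * ((t * h) * (2 * `|B|))) + K * (t * h * h)) =
    2^-1 * (K * (4 * `|B| + 1) * t * h ^+ 2) by ring.
  rewrite ler_piMl ?invf_le1 ?ler1n //.
  by rewrite !mulr_ge0 ?(ltW t0) ?exprn_ge0 ?(ltW h0) // addr_ge0 // mulr_ge0.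
have -> : w * (K * (4 * `|B| + 1) * t * h ^+ 2) =
  (t * (w * K * (4 * `|B| + 1))) * h ^+ 2 by ring.
rewrite ler_wpM2r ?exprn_ge0 ?(ltW h0) //; apply: le_trans tQ.
by rewrite ler_wpM2l ?(ltW t0) // /Q lerDl.
Qed.

Variables (w : nat -> R) (w0 : forall i, 0 < w i).
Local Notation M := (@model R n w w0).

(** A torus chart [b] at [phi x] provides the lift [coord b \o phi]; changing from [c] to [b] turns
    the form into a multiple of the standard one. *)
Lemma model_lift (phi : 'rV[R]_2 -> points M) x c A :
  {for x, continuous phi} -> atlas c -> dom c (phi x) ->
  strict_diff (coord c \o phi) x A ->
  exists i F B, [/\ \forall y \near x, phi y = proj i (F y),
    strict_diff F x B &
    w i * (B *m std_form *m B^T) ord0 ord_max =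
    (A *m form_comp (symp_form M) c (phi x) *m A^T) ord0 ord_max].
Proof.
move=> cphi ac cx dA.
have [i [z xz]] := proj_surj (phi x).
have [y [b [yz bE bB bx]]] := torus_base_proj i z.
rewrite -xz in bx; have ab := model_atlas w0 bB.
have [g gE] := atlas_compatible ac ab cx bx.
have [W [oW Wx sg WE]] := gE.
have dg := smooth_on_strict_diff oW sg Wx.
have nb : \forall q \near x, dom b (phi q).
  apply: cphi; apply: open_nbhs_nbhs; split=> //.
  by case: (atlas_is_chart ab).
have nc : \forall q \near x, dom c (phi q).
  apply: cphi; apply: open_nbhs_nbhs; split=> //.
  by case: (atlas_is_chart ac).
have nW : \forall q \near x, W ((coord c \o phi) q).
  by apply: (strict_diff_continuous dA); apply: open_nbhs_nbhs.
exists i, (coord b \o phi), (A *m 'J g (coord c (phi x))); split.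
- apply: filterS nb => q; rewrite bE => -[v yv vq].
  by rewrite -[LHS]vq -[v in LHS](torus_chart_proj i yv) vq.
- have := strict_diff_comp dA dg; apply: strict_diff_near.
  have := near_and nb (near_and nc nW); apply: filterS => q [bq [cq Wq]].
  exact: WE.
- rewrite (form_transform (symp_form M) ac ab cx bx gE).
  rewrite model_form_base // xz sheetE trmx_mul !mulmxA.
  by rewrite -!scalemxAr -!scalemxAl [RHS]mxE.
Qed.

Definition grid_square (phi : 'rV[R]_2 -> X) (r e h : R) (p : 'rV[R]_2) : Prop :=
  small_quad w (r * h ^+ 2) (e * h ^+ 2) (phi p) (phi (p + h *: e0))
    (phi (p + h *: e0 + h *: e1)) (phi (p + h *: e1)).

Lemma grid_square_near (phi : 'rV[R]_2 -> X) (r e : R) x i F B : 0 < e ->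
  (\forall y \near x, phi y = proj i (F y)) -> strict_diff F x B ->
  w i * (B *m std_form *m B^T) ord0 ord_max = r ->
  exists2 d, 0 < d & forall p h, 0 < h -> `|p - x| + h < d ->
    grid_square phi r e h p.
Proof.
move=> e_gt0 /near_normP[d1 d10 phiF] dF Br.
have [d2 d20 area] := square_quad_area dF e_gt0 (w0 i).
(* Two values within 1/8 of [F x] are less than 1/4 apart, as a small quadrilateral demands. *)
have /continuous_normP/(_ 8^-1)[|d3 d30 Fd] := strict_diff_continuous dF; first by lra.
exists (Num.min d1 (Num.min d2 d3)) => [|p h h0].
  by rewrite !lt_min d10 d20.
rewrite !lt_min => /and3P[ph1 ph2 ph3].
have he k : `|h *: (delta_mx 0 k : 'rV[R]_2)| <= h.
  by rewrite normrZ (gtr0_norm h0) ler_piMr ?(ltW h0) // delta_mx_norm_le.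
have h01 : `|h *: e0 + h *: e1| <= h.
  rewrite -scalerDr normrZ (gtr0_norm h0) ler_piMr ?(ltW h0) //.
  apply: mx_norm_le => // a b; rewrite !mxE.
  have [->|->] := ord2P b.
    by rewrite !ord1 /= addr0 normr1.
  by rewrite !ord1 /= add0r normr1.
have nearp (v : 'rV[R]_2) d : `|p - x| + h < d -> `|v| <= h -> `|p + v - x| < d.
  move=> phd vh; rewrite addrAC; apply: le_lt_trans (ler_normD _ _) _.
  by apply: le_lt_trans phd; rewrite lerD2l.
have near0 d : `|p - x| + h < d -> `|p - x| < d.
  by apply: le_lt_trans; rewrite lerDl ltW.
have Fd2 u v : `|u - x| < d3 -> `|v - x| < d3 -> `|F u - F v| < 4^-1.
  move=> /Fd u8 /Fd v8; rewrite -(subrK (F x) (F u)) -addrA.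
  apply: le_lt_trans (ler_normD _ _) _; rewrite (distrC (F x)).
  by apply: lt_le_trans (ltrD u8 v8) _; lra.
have nd3 (v : 'rV[R]_2) : `|v| <= h -> `|p + v - x| < d3 by exact: nearp.
have nd1 (v : 'rV[R]_2) : `|v| <= h -> `|p + v - x| < d1 by exact: nearp.
have p11 : p + h *: e0 + h *: e1 = p + (h *: e0 + h *: e1) by rewrite addrA.
exists i, (F p), (F (p + h *: e0)), (F (p + h *: e0 + h *: e1)), (F (p + h *: e1)).
split.
- split; first by rewrite phiF // near0.
  + by rewrite phiF // nd1.
  + by rewrite phiF // p11 nd1.
  + by rewrite phiF // nd1.
- have n00 := near0 _ ph3; rewrite !p11.
  have n10 := nd3 _ (he ord0); have n01 := nd3 _ (he ord_max); have n11 := nd3 _ h01.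
  by split; exact: Fd2.
- by rewrite -Br; exact: area.
Qed.

(** Multiples of [a] are spaced [a] apart. If the multiple within [a / 4] of [r] were not [r], one
    at most half as far would have to be the same multiple. *)
Lemma integer_multiple_closed (a r : R) : 0 < a ->
  (forall e, 0 < e -> exists z : int, `|a * z%:~R - r| <= e) ->
  exists z : int, r = a * z%:~R.
Proof.
move=> a0 close; have [|z1 z1E] := close (a / 4); first by lra.
have [->|rz1] := eqVneq r (a * z1%:~R); first by exists z1.
have d0 : 0 < `|a * z1%:~R - r| by rewrite normr_gt0 subr_eq0 eq_sym.
have [|z2 z2E] := close (`|a * z1%:~R - r| / 2); first by lra.
have : `|a * (z1 - z2)%:~R| < a.
  rewrite intrB mulrBr -[X in X - _](subrK r) -addrA.
  apply: le_lt_trans (ler_normD _ _) _; rewrite (distrC r); lra.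
rewrite normrM gtr0_norm // gtr_pMr // -intr_norm ltrz1 => zz.
have {}zz : z1 = z2 by lia.
by rewrite -zz in z2E; lra.
Qed.

Lemma near_right0P (P : set R) : (\forall h \near 0^'+, P h) <->
  exists2 d, 0 < d & forall h, 0 < h < d -> P h.
Proof.
rewrite near_withinE; split=> [/near_normP[d d0 dP]|[d d0 dP]].
  exists d => // h /andP[h0 hd]; apply: dP => //.
  by rewrite subr0 gtr0_norm.
suff : \forall h \near (0 : R), 0 < h -> P h by [].
apply/near_normP; exists d => // h; rewrite subr0 => hd h0.
by apply: dP; rewrite h0 -[h]gtr0_norm.
Qed.

Lemma torus_period_model r : torus_period M r ->
  exists i (z : int), r = w i * z%:~R.
Proof.
move=> [phi [cphi perphi phiE]].
exists (sheet (phi 0)).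
apply: integer_multiple_closed; first exact: w0.
move=> e e_gt0.
(* Compactness of the unit square yields one mesh size that works at all its points. *)
pose K : set 'rV[R]_2 := [set v | forall k, `[0, 1]%classic (v ord0 k)].
have cK : compact K.
  exact: (@rV_compact R 2 _ (fun=> @segment_compact R 0 1)).
have near_h : \forall h \near (0 : R)^'+, K `<=` grid_square phi r e h.
  move/compact_near_coveringP : cK; apply => x Kx.
  have [c [A [ac cx dA Ar]]] := phiE x.
  have [i [F [B [phiF dF Br]]]] := model_lift (cphi x) ac cx dA.
  have [d d0 dE] := grid_square_near e_gt0 phiF dF (etrans Br Ar).
  have d20 : 0 < d / 2 by rewrite divr_gt0.
  exists (norm_ball x (d / 2), [set h | 0 < h < d / 2]).
    split; last by apply/near_right0P; exists (d / 2).
    by apply: open_nbhs_nbhs; split; [exact: open_norm_ball|exact: norm_ball_center].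
  move=> [p h] /= [px /andP[h0 hd]]; apply: dE => //.
  by rewrite [ltRHS]splitr ltrD.
have [d d0 dK] : exists2 d, 0 < d & forall h, 0 < h < d -> K `<=` grid_square phi r e h.
  exact/near_right0P.
(* The mesh is the inverse of an integer, so that the grid closes up under the unit periods. *)
pose N := (Num.truncn d^-1).+1; pose h : R := N%:R^-1.
have N0 : 0 < N%:R :> R by rewrite ltr0n.
have h0 : 0 < h by rewrite invr_gt0.
have hd : h < d.
  by rewrite -[d]invrK ltf_pV2 ?posrE ?invr_gt0 //; exact: truncnS_gt.
have KG : K `<=` grid_square phi r e h by apply: dK; rewrite h0.
have hN : h * N%:R = 1 by rewrite mulVf ?gt_eqF.
pose p k l : 'rV[R]_2 := (k%:R * h) *: e0 + (l%:R * h) *: e1.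
have per k (q : nat) x : phi (x + q%:R *: delta_mx 0 k) = phi x.
  elim: q => [|q IHq]; first by rewrite scale0r addr0.
  by rewrite -natr1 scalerDl scale1r addrA perphi.
have pE k l : p k l = p (k %% N)%N (l %% N)%N + (k %/ N)%N%:R *: e0 + (l %/ N)%N%:R *: e1.
  have E (a : nat) : a%:R * h = (a %% N)%N%:R * h + (a %/ N)%N%:R.
    by rewrite {1}(divn_eq a N) natrD natrM mulrDl -mulrA [N%:R * h]mulrC hN mulr1 addrC.
  by rewrite /p (E k) (E l) !scalerDl addrACA addrA.
have phip k l v : phi (p k l + v) = phi (p (k %% N)%N (l %% N)%N + v).
  by rewrite pE addrAC per addrAC per.
have p1 k l : p k.+1 l = p k l + h *: e0.
  by rewrite /p -natr1 mulrDl mul1r scalerDl addrAC.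
have p2 k l : p k l.+1 = p k l + h *: e1.
  by rewrite /p -natr1 mulrDl mul1r scalerDl addrA.
have square k l : grid_square phi r e h (p k l).
  have Kp : K (p (k %% N)%N (l %% N)%N).
    move=> a; rewrite /= in_itv /=.
    have -> : p (k %% N)%N (l %% N)%N ord0 a =
        (if a == ord0 then (k %% N)%N%:R else (l %% N)%N%:R) * h.
      rewrite !mxE; have [->|->] := ord2P a.
        by rewrite /= mulr1 mulr0 addr0.
      by rewrite /= mulr0 mulr1 add0r.
    have b1 (b : nat) : 0 <= (b %% N)%N%:R * h <= 1.
      rewrite mulr_ge0 ?(ltW h0) //= ler_pdivrMr // mul1r ler_nat.
      by rewrite ltnW // ltn_mod.
    by case: ifP.
  have H0 : phi (p k l) = phi (p (k %% N)%N (l %% N)%N).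
    by rewrite -[p k l]addr0 (phip k l) addr0.
  have H3 : phi (p k l + h *: e0 + h *: e1) =
      phi (p (k %% N)%N (l %% N)%N + h *: e0 + h *: e1).
    by rewrite -(addrA (p k l)) (phip k l) addrA.
  by rewrite /grid_square H3 H0 !(phip k l); exact: KG.
have pmod k l k' l' : k = k' %[mod N] -> l = l' %[mod N] ->
    phi (p k l) = phi (p k' l').
  move=> kk' ll'; rewrite -[p k l]addr0 (phip k l) kk' ll' -(phip k' l').
  by rewrite addr0.
have [||| z zE] := @periodic_grid_area _ _ w N (fun k l => phi (p k l)) (r * h ^+ 2) (e * h ^+ 2).
- by move=> k l; apply: pmod; rewrite ?modnDr.
- by move=> k l; apply: pmod; rewrite ?modnDr.
- by move=> k l; have := square k l; rewrite /grid_square p2 !p1 p2.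
(* The [N * N] squares of area [h ^+ 2] fill the unit square, so that the total error is [e]
   again. *)
have NN (t : R) : (N * N)%:R * (t * h ^+ 2) = t.
  have -> : (N * N)%:R * (t * h ^+ 2) = t * (h * N%:R) ^+ 2.
    by rewrite natrM; ring.
  by rewrite hN expr1n mulr1.
exists z; rewrite !NN in zE; move: zE.
by rewrite /p !mul0r !scale0r addr0.
Qed.

(** The plane of the first symplectic pair of coordinates, mapped linearly into sheet [i], has area
    density [w i]. *)
Lemma torus_period_model_weight i : (0 < n)%N -> torus_period M (w i).
Proof.
move=> n0; have n2 : (2 <= 2 * n)%N by lia.
pose E : 'M[R]_(2, 2 * n) := rowsub (widen_ord n2) 1%:M.
have Eint (x : 'rV[R]_2) k : integral (delta_mx 0 k *m E).
  by rewrite -rowE => j; rewrite !mxE; case: (_ == _); rewrite ?rpred0 ?rpred1.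
have ES : (E *m std_form *m E^T) ord0 ord_max = 1.
  rewrite /E mul_rowsub_mx mul1mx !mxE (bigD1 (widen_ord n2 ord_max)) //= big1.
    by rewrite addr0 !mxE eqxx /= mulr1.
  move=> k kE; rewrite [X in _ * X](_ : _ = 0) ?mulr0 //.
  by rewrite !mxE eq_sym (negbTE kE).
pose phi (x : 'rV[R]_2) : points M := proj i (x *m E).
exists phi; split=> [x|x k|x].
- apply: (@continuous_comp 'rV[R]_2 V X (fun x => x *m E) (proj i)).
    exact: strict_diff_continuous (strict_diff_linear x E).
  exact: proj_continuous.
- apply/proj_eq; split=> //; rewrite mulmxDl addrC addKr; exact: Eint.
have [y [b [yx bE bB bx]]] := torus_base_proj i (x *m E).
exists b, E; split=> //; first exact: model_atlas.
  have [v yv vx] : dom (torus_chart i y) (proj i (x *m E)) by rewrite -bE.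
  have /proj_eq[_ vxE] := vx.
  pose s := v - x *m E.
  have ds : strict_diff (fun z => z *m E + s) x E by exact: strict_diff_affine.
  apply: (strict_diff_near _ ds).
  have xv : x *m E + s = v by rewrite addrC subrK.
  have nb := continuous_near_open (strict_diff_continuous ds) (open_norm_ball y 4^-1).
  rewrite xv in nb; have {}nb := nb yv.
  apply: filterS nb => z yz; rewrite bE /=.
  rewrite -[LHS](torus_chart_proj i yz); congr (coord _ _).
  by apply/proj_eq; split=> //; rewrite addrC addKr.
by rewrite model_form_base // sheetE -scalemxAr -scalemxAl [LHS]mxE ES mulr1.
Qed.

End ModelPeriods.

(** * Counting capacities *)

Section PrimeBranches.

Fixpoint prime_seq (k : nat) : nat :=
  if k is k'.+1 then s2val (prime_above (prime_seq k'))
  else s2val (prime_above 0).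

Lemma prime_seq_prime k : prime (prime_seq k).
Proof. by case: k => [|k] /=; case: prime_above. Qed.

Lemma prime_seq_inj : injective prime_seq.
Proof.
have H : {homo prime_seq : i j / (i < j)%N}.
  by apply: homo_ltn => [? ? ?|k /=]; [exact: ltn_trans|case: prime_above].
move=> i j ij; case: (ltngtP i j) => // /H; by rewrite ij ltnn.
Qed.

Lemma injective_unbounded (f : nat -> nat) (u : nat) : injective f ->
  exists k, (u < f k)%N.
Proof.
move=> fi; apply: contrapT => /forallNP fu.
have fl k : (f k < u.+1)%N by rewrite ltnS leqNgt; exact/negP.
pose g (k : 'I_u.+2) : 'I_u.+1 := Ordinal (fl k).
have gi : injective g by move=> a b [/fi/val_inj].
by have := leq_card g gi; rewrite !card_ord ltnn.
Qed.

Definition branch_prefix (x : set nat) (k : nat) : seq bool :=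
  mkseq (fun j => `[< x j >]) k.

(* An almost disjoint family, given by the branches of the binary tree. *)
Definition branch_primes (x : set nat) : set nat :=
  [set p | exists k, p = prime_seq (pickle (branch_prefix x k))].

Lemma branch_primes_prime x p : branch_primes x p -> prime p.
Proof. by move=> [k ->]; exact: prime_seq_prime. Qed.

(** Prefixes of [x] of length at least [j.+1] contain the entry [j] where [x] and [y] differ, so
    that they are not prefixes of [y]; there are infinitely many of them, hence unbounded primes. *)
Lemma branch_primes_separate (x y : set nat) (u : nat) : x <> y ->
  exists p, [/\ (u < p)%N, branch_primes x p & ~ branch_primes y p].
Proof.
move=> xy; have /existsNP[j xyj] : ~ forall j, x j = y j.
  by move=> E; apply: xy; apply/funext.
pose f k := prime_seq (pickle (branch_prefix x (j.+1 + k))).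
have [k uk] : exists k, (u < f k)%N.
  apply: injective_unbounded => a b /prime_seq_inj/(pcan_inj pickleK).
  by move/(congr1 size); rewrite !size_mkseq => /addnI.
exists (f k); split=> //; first by exists (j.+1 + k)%N.
move=> [l /prime_seq_inj/(pcan_inj pickleK) E].
have ls : l = (j.+1 + k)%N by move/(congr1 size) : E; rewrite !size_mkseq.
have := congr1 (fun s => nth false s j) E.
rewrite !nth_mkseq ?ls ?leq_addr // => xyE; apply: xyj; apply/propext.
by rewrite -(asboolE (x j)) -(asboolE (y j)) xyE.
Qed.

End PrimeBranches.

Section Weights.
Context {R : realType}.

Definition weight_den (x : set nat) (i : nat) : nat :=
  if `[< branch_primes x i >] then i else 1%N.

Definition weight (x : set nat) (i : nat) : R := (weight_den x i)%:R^-1.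

Lemma weight_den_gt0 x i : (0 < weight_den x i)%N.
Proof.
by rewrite /weight_den; case: ifP => // /asboolP/branch_primes_prime/prime_gt0.
Qed.

Lemma weight_gt0 x i : 0 < weight x i.
Proof. by rewrite invr_gt0 ltr0n weight_den_gt0. Qed.

Lemma weight_den0 x : weight_den x 0 = 1%N.
Proof.
by rewrite /weight_den; case: ifP => // /asboolP/branch_primes_prime.
Qed.

(** The other factors being positive, [z] is positive too, and the denominators can be cleared. *)
Lemma weight_multiple (a : R) x y i : 0 < a ->
  (exists j (z : int), a * weight x i = weight y j * z%:~R) ->
  exists j u, (0 < u)%N /\ a * (weight_den y j)%:R = (u * weight_den x i)%:R.
Proof.
move=> a0 [j [z E]]; exists j, `|z|%N.
have dy : 0 < (weight_den y j)%:R :> R by rewrite ltr0n weight_den_gt0.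
have dx : 0 < (weight_den x i)%:R :> R by rewrite ltr0n weight_den_gt0.
have z0 : 0 < z.
  rewrite -(ltr0z R) -(pmulr_rgt0 _ (weight_gt0 y j)) -E.
  by rewrite mulr_gt0 // weight_gt0.
split; first by rewrite absz_gt0 gt_eqF.
have zE : (`|z|%N)%:R = z%:~R :> R by rewrite pmulrn gez0_abs // ltW.
rewrite natrM zE; move: E; rewrite /weight => /(congr1 (fun t => t *
  (weight_den x i)%:R * (weight_den y j)%:R)).
by rewrite mulfVK ?gt_eqF // => ->; field; rewrite gt_eqF.
Qed.

Lemma weight_rigid (a : R) (x y : set nat) : 0 < a ->
  (forall i, exists j (z : int), a * weight x i = weight y j * z%:~R) -> x = y.
Proof.
move=> a0 xy; apply: contrapT => nxy.
(* As 0 is not prime, it carries the weight 1, and this index expresses [a] itself as a fraction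
   with numerator [u]. *)
have [j0 [u [u0 E0]]] := weight_multiple a0 (xy 0%N).
rewrite weight_den0 muln1 in E0.
have [p [up xp yp]] := branch_primes_separate u nxy.
have pp := branch_primes_prime xp.
have [j [v [v0 E]]] := weight_multiple a0 (xy p).
have dp : weight_den x p = p by rewrite /weight_den asboolT.
rewrite dp in E.
(* Eliminating [a] leaves an identity of natural numbers. The prime [p > u] does not divide [u], so
   it divides [weight_den y j], which must then be [p] itself. *)
have : (u * weight_den y j = v * p * weight_den y j0)%N.
  apply/eqP; rewrite -(eqr_nat R) 2!natrM -E0 -E; apply/eqP; ring.
move=> uv; have : (p %| u * weight_den y j)%N by rewrite uv -mulnA mulnCA dvdn_mulr.
rewrite Euclid_dvdM // => /orP[/(dvdn_leq u0)|].
  by rewrite leqNgt up.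
rewrite /weight_den; case: ifP => [/asboolP yj|_]; last first.
  by rewrite dvdn1 => /eqP p1; rewrite p1 in pp.
have := branch_primes_prime yj => /prime_nt_dvdP pj pdj.
have p1 : p != 1%N by apply: contraTneq pp => ->.
by have := pj _ p1 => /(_ pdj) E'; apply: yp; rewrite E'.
Qed.

End Weights.

(** * Comparability of cardinals *)

Section Cardinality.

(** A maximal partial bijection, given by Zorn's lemma, exhausts [A] or [B]: otherwise a pair of
    missed points could be added. *)
Lemma card_le_total T U (A : set T) (B : set U) : (A #<= B) || (B #<= A).
Proof.
pose P (F : set (T * U)) := F `<=` A `*` B /\
  forall p q, F p -> F q -> p.1 = q.1 <-> p.2 = q.2.
have [F [[FAB Finj] Fmax]] : exists F, P F /\ forall F', F `<` F' -> ~ P F'.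
  apply: Zorn_bigcup => C CP Ctot; split=> [p [F CF Fp]|p q [F CF Fp] [F' CF' Fq]].
    by have [+ _] := CP F CF; apply.
  have [FF'|F'F] := Ctot F F' CF CF'.
    by have [_] := CP F' CF'; apply=> //; exact: FF'.
  by have [_] := CP F CF; apply=> //; exact: F'F.
have injF1 : {in F &, injective (fst : T * U -> T)}.
  move=> p q; rewrite !inE => Fp Fq pq; have := (Finj p q Fp Fq).1 pq.
  by case: p q pq {Fp Fq} => [? ?] [? ?] /= -> ->.
have injF2 : {in F &, injective (snd : T * U -> U)}.
  move=> p q; rewrite !inE => Fp Fq pq; have := (Finj p q Fp Fq).2 pq.
  by case: p q pq {Fp Fq} => [? ?] [? ?] /= -> ->.
have F12 : fst @` F #= snd @` F.
  exact: card_eq_trans (inj_card_eq injF1) (card_esym (inj_card_eq injF2)).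
have [[a [Aa Fa]]|/forallNP FA] := pselect (exists a, A a /\ ~ (fst @` F) a); last first.
  apply/orP; left; apply: (@card_le_trans _ _ _ (snd @` F)).
    rewrite -(card_le_eqr F12); apply: subset_card_le => a Aa.
    by apply: contrapT => Fa; exact: (FA a).
  by apply: subset_card_le => _ [p /FAB[_ Bp] <-].
have [[b [Bb Fb]]|/forallNP FB] := pselect (exists b, B b /\ ~ (snd @` F) b); last first.
  apply/orP; right; apply: (@card_le_trans _ _ _ (fst @` F)).
    rewrite (card_le_eqr F12); apply: subset_card_le => b Bb.
    by apply: contrapT => Fb; exact: (FB b).
  by apply: subset_card_le => _ [p /FAB[Ap _] <-].
exfalso; apply: (Fmax (F `|` [set (a, b)])).
  split; first by move=> p Fp; left.
  by move=> /(_ (a, b))/(_ (or_intror erefl)) Fab; apply: Fa; exists (a, b).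
split=> [p [/FAB//|->//]|p q [Fp|->] [Fq|->] //=].
- exact: Finj.
- by split=> E; exfalso; [apply: Fa|apply: Fb]; exists p.
- by split=> E; exfalso; [apply: Fa|apply: Fb]; exists q.
Qed.

End Cardinality.

(** * The capacity attached to a set of sets of natural numbers *)

Section Capacities.
Context {R : realType} {n : nat}.
Local Notation symp := (symp R n).

(** The scale 0 is included so that the supremum is never taken over the empty set and is
    nonnegative. *)
Definition period_scales (I : set (set nat)) (M : symp) : set R :=
  [set a | a = 0 \/ 0 < a /\ exists2 x, I x &
    forall i, torus_period M (a * weight x i)].

Definition period_capacity (I : set (set nat)) (M : symp) : \bar R :=
  ereal_sup [set a%:E | a in period_scales I M].

Lemma period_scales_scale I (M : symp) (a b : R) (a_gt0 : 0 < a) :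
  period_scales I (scale a_gt0 M) (a * b) <-> period_scales I M b.
Proof.
split=> -[b0|[b0 [x Ix bP]]].
- left; apply: (mulfI (lt0r_neq0 a_gt0)); rewrite b0 mulr0 //.
- right; split; first by rewrite pmulr_rgt0 in b0.
  by exists x => // i; apply: (torus_period_unscale (a_gt0 := a_gt0)); rewrite mulrA.
- by left; rewrite b0 mulr0.
- right; split; first by rewrite mulr_gt0.
  by exists x => // i; rewrite -mulrA; exact: torus_period_scale.
Qed.

Lemma period_capacity_generalized I : generalized_capacity (period_capacity I).
Proof.
split=> [M|M N f sf|a a_gt0 M].
- by apply: ereal_sup_ubound; exists 0 => //; left.
- apply: ereal_sup_le => _ [a aM <-]; exists a => //; case: aM => [->|[a0 [x Ix aP]]].
    by left.
  by right; split=> //; exists x => // i; exact: torus_period_embedding sf (aP i).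
- rewrite -ereal_sup_pZl //; congr ereal_sup; apply/seteqP; split=> y.
    move=> [b bM <-]; exists (a^-1 * b)%:E.
      exists (a^-1 * b) => //; apply/(period_scales_scale _ _ _ a_gt0).
      by rewrite mulVKf ?gt_eqF.
    by rewrite -EFinM mulVKf ?gt_eqF.
  move=> [_ [b bM <-] <-]; exists (a * b) => //.
  exact/period_scales_scale.
Qed.

Definition branch_model (x : set nat) : symp := model (n := n) (@weight_gt0 R x).

(** For [y] in [I] the scale 1 is admissible. For [y] outside [I], a positive scale would identify
    [y] with an element of [I] by rigidity of the weights, so that the supremum is 0. *)
Lemma period_capacity_model I y : (0 < n)%N ->
  (1 <= period_capacity I (branch_model y))%E <-> I y.
Proof.
move=> n0; split=> [|Iy]; last first.
  apply: ereal_sup_ubound; exists 1 => //; right; split=> //.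
  by exists y => // i; rewrite mul1r; exact: torus_period_model_weight.
apply: contraPP => nIy; apply/negP; rewrite -ltNge.
apply: (@le_lt_trans _ _ 0%E); last by rewrite lte01.
apply: ge_ereal_sup => _ [a + <-] => -[->//|[a0 [x Ix aP]]].
case: nIy; suff <- : x = y by [].
by apply: (weight_rigid a0) => i; exact: torus_period_model (aP i).
Qed.

End Capacities.

(** * Coding sequences of minima and maxima by sets of natural numbers *)

Section Codes.
Context {R : realType}.

(** Real numbers enter through their rational cuts, so that a countable array of reals, the lengths
    and the choices of minimum or maximum fit into a subset of a countable type. *)
Definition array_graph (F : nat -> nat -> R) (l : nat -> nat) (b : nat -> bool) :
    set ((nat * nat * rat) + (nat * nat) + nat) :=
  [set t | match t with
    | inl (inl kjq) => ratr kjq.2 < F kjq.1.1 kjq.1.2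
    | inl (inr kl) => kl.2 = l kl.1
    | inr k => b k
    end].

Definition array_code F l b : set nat := pickle @` array_graph F l b.

Lemma array_code_inj F l b F' l' b' :
  array_code F l b = array_code F' l' b' -> [/\ F = F', l = l' & b = b'].
Proof.
move=> /image_pickle_inj E; split.
- apply/funext => k; apply/funext => j; apply: rat_cut_inj => q.
  by have := congr1 (@^~ (inl (inl (k, j, q)))) E => /= ->.
- apply/funext => k; have := congr1 (@^~ (inl (inr (k, l k)))) E => /=.
  by move=> H; have : l k = l' k by rewrite -H.
- apply/funext => k; have := congr1 (@^~ (inr k)) E => /= H.
  by apply/idP/idP => bk; [rewrite -H|rewrite H].
Qed.

End Codes.

Section Counting.
Context {R : realType} {n : nat}.
Local Notation symp := (symp R n).
Variables (G : set (symp -> \bar R)) (e : (symp -> \bar R) -> R).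
Hypothesis e_inj : {in G &, injective e}.

(* [b k] selects the minimum or the maximum of the first [l k] terms of [cs k];
   the other terms are irrelevant. *)
Definition coded (y : set nat) (c : symp -> \bar R) : Prop :=
  exists (cs : nat -> nat -> symp -> \bar R) (l : nat -> nat) (b : nat -> bool),
    [/\ forall k j, (j < l k)%N -> G (cs k j),
        y = array_code (fun k j => e (cs k j)) l b &
        forall M, (fun k => (if b k then @min_coord R (l k) else @max_coord R (l k))
          (fun i => cs k i M)) @ \oo --> c M].

(** The code determines the lengths, the choices and, by injectivity of [e] on [G], the relevant
    terms, hence the whole sequence and its limit. *)
Lemma coded_unique y c c' : coded y c -> coded y c' -> c = c'.
Proof.
move=> [cs [l [b [csG yE cl]]]] [cs' [l' [b' [csG' yE' cl']]]].
move: yE'; rewrite yE => /array_code_inj[Ecs El Eb]; subst l' b'.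
have csE k j : (j < l k)%N -> cs k j = cs' k j.
  move=> jl; apply: e_inj; rewrite ?inE; [exact: csG|exact: csG'|].
  by move: (congr1 (fun F => F k j) Ecs).
apply/funext => M; apply: (cvg_unique (@ereal_hausdorff R) (cl M)).
rewrite (_ : (fun _ => _) = (fun k => (if b k then @min_coord R (l k)
  else @max_coord R (l k)) (fun i => cs' k i M))); first exact: cl'.
apply/funext => k; congr (_ _); apply/funext => i.
by rewrite csE.
Qed.

Lemma coded_exists c : (exists h : nat -> symp -> \bar R,
    (forall k, min_max_combination G (h k)) /\
    (forall M, (fun k => h k M) @ \oo --> c M)) ->
  exists y, coded y c.
Proof.
move=> [h [hG hc]].
pose P k (lb : nat * bool * (nat -> symp -> \bar R)) :=
  (forall j, (j < lb.1.1)%N -> G (lb.2 j)) /\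
  forall M, h k M = (if lb.1.2 then @min_coord R lb.1.1 else @max_coord R lb.1.1)
    (fun i => lb.2 i M).
have /boolp.choice[D DE] : forall k, exists lb, P k lb.
  move=> k; have [l [cs [F [csG FE hE]]]] := hG k.
  (* The zero function pads the list beyond [l], where no minimum or maximum reads it. *)
  pose cs' j : symp -> \bar R := if insub j is Some i then cs i else fun=> 0%E.
  have cs'E (i : 'I_l) : cs' i = cs i.
    by rewrite /cs' valK.
  have csM M : (fun i : 'I_l => cs' i M) = (fun i => cs i M).
    by apply/funext => i; rewrite cs'E.
  have cs'G j : (j < l)%N -> G (cs' j).
    by move=> jl; rewrite -[j]/(val (Ordinal jl)) cs'E; exact: csG.
  case: FE => FE.
    by exists (l, true, cs'); split=> //= M; rewrite hE FE csM.
  by exists (l, false, cs'); split=> //= M; rewrite hE FE csM.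
pose cs k := (D k).2; pose l k := (D k).1.1; pose b k := (D k).1.2.
exists (array_code (fun k j => e (cs k j)) l b), cs, l, b; split=> //.
  by move=> k j; have [+ _] := DE k; exact.
move=> M; rewrite (_ : (fun _ => _) = (fun k => h k M)) //.
by apply/funext => k; have [_ ->] := DE k.
Qed.

End Counting.

Theorem theorem5 (R : realType) (n : nat) (hn : (2 <= n)%N)
    (G : set (symp R n -> \bar R)) (hG : limit_min_max_generating G) :
  ([set: R] #<= G) /\ ~ (G #<= [set: R]).
Proof.
suff nG : ~ (G #<= [set: R]).
  by split=> //; case/orP: (card_le_total [set: R] G).
move=> /pcard_leP[e].
have e_inj : {in G &, injective e} by exact: inj.
have n0 : (0 < n)%N by exact: ltn_trans hn.
(* Cantor's diagonal argument. *)
pose I : set (set nat) := [set y | exists2 c, coded G e y c &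
  ~ (1 <= c (branch_model y))%E].
(* The capacity of [I] is tested at the model of its own code [y], where it would be at least 1 if
   and only if it is not. *)
have [y yc] := coded_exists e (hG.2 _ (period_capacity_generalized I)).
have [one|/negP none] := boolP (1 <= period_capacity I (@branch_model R n y))%E.
  have [c yc' none] := (period_capacity_model I y n0).1 one.
  by apply: none; rewrite -(coded_unique e_inj yc yc').
by apply: (none); apply/(period_capacity_model I y n0); exists (period_capacity I).
Qed.
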